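(* There exist a function $f\in C^2(\mathbb R)$, $f:\mathbb R\to\mathbb R$, with a bounded second derivative, a sequence $\{\mathcal H_n\}_{n\ge 1}$ of finite dimensional Hilbert spaces with Hilbertian direct sum $\mathcal H=\bigoplus_{n\ge 1}\mathcal H_n$, a self-adjoint (possibly unbounded) operator $A=\bigoplus_{n\ge1}A_n$ on $\mathcal H$ with each $A_n\in B(\mathcal H_n)$ self-adjoint, and a self-adjoint operator $B=\bigoplus_{n\ge1}B_n\in\mathcal S^2(\mathcal H)$ with each $B_n\in B(\mathcal H_n)$ self-adjoint, such that $$ f(A+B)-f(A)-\frac{d}{dt}\Big(f(A+tB)\Big)\Big|_{t=0}\notin\mathcal S^1(\mathcal H). $$
   Context: $\mathcal S^1(\mathcal H)$ and $\mathcal S^2(\mathcal H)$ denote the trace class and the Hilbert-Schmidt class on a Hilbert space $\mathcal H$. For a sequence $\{A_n\}$ of self-adjoint operators $A_n\in B(\mathcal H_n)$, the direct sum $A=\bigoplus_n A_n$ is the self-adjoint operator with domain $D(A)=\{\{\xi_n\}\in\mathcal H:\sum_n\|A_n(\xi_n)\|^2<\infty\}$, given by $A(\{\xi_n\})=\{A_n(\xi_n)\}$. For self-adjoint $B_n\in B(\mathcal H_n)$ with $\sum_n\|B_n\|_2^2<\infty$, the operator $B=\bigoplus_n B_n$ is in $\mathcal S^2(\mathcal H)$ and $\|B\|_2^2=\sum_n\|B_n\|_2^2$. For $f\in C^2(\mathbb R)$ with bounded second derivative and $A,B$ of this form, the operator in the claim is by definition the block diagonal operator $$ f(A+B)-f(A)-\frac{d}{dt}\Big(f(A+tB)\Big)\Big|_{t=0}:=\bigoplus_{n=1}^\infty\Big(f(A_n+B_n)-f(A_n)-\frac{d}{dt}\Big(f(A_n+tB_n)\Big)\Big|_{t=0}\Big),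 $$ which is an element of $\mathcal S^2(\mathcal H)$. Here, on each finite dimensional $\mathcal H_n$, $f$ is applied by functional calculus and $\frac{d}{dt}(f(A_n+tB_n))|_{t=0}$ is the usual derivative of the differentiable matrix-valued map $t\mapsto f(A_n+tB_n)$ at $t=0$. *)

(* Defs.v *)
(* MathComp / MathComp-Analysis *)
From HB Require Import structures.
From mathcomp Require Import all_boot all_order all_algebra.
From mathcomp Require Import all_classical all_reals all_analysis.
From mathcomp.real_closed Require Import complex.
From mathcomp Require Import ring.

Set Implicit Arguments.
Unset Strict Implicit.
Unset Printing Implicit Defensive.

Import Order.TTheory GRing.Theory Num.Theory.
Import numFieldNormedType.Exports.

Local Open Scope ring_scope.
Local Open Scope classical_set_scope.
Local Open Scope complex_scope.

(* [R[i]] as a normed space over itself, with the topology given by the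
   modulus. *)
HB.instance Definition _ (R : realType) := NormedModule.copy R[i] R[i]^o.

Definition C2_bounded_second_derivative (R : realType) (f : R -> R) : Prop :=
  [/\ forall x, derivable f x 1,
      forall x, derivable (f^`()) x 1,
      continuous (f^`(2)) &
      exists M : R, forall x, `|f^`(2) x| <= M].

Section FiniteDimensional.
Context {R : realType}.

(* Linear in the first argument. *)
Definition cdot k (u v : 'cV[R[i]]_k) : R[i] :=
  \sum_(j < k) u j ord0 * Num.conj (v j ord0).

Definition normsq k (u : 'cV[R[i]]_k) : R := complex.Re (cdot u u).

(* For Hermitian [A], [A = P^-1 *m diag_mx (spectral_diag A) *m P] with
   [P = spectralmx A] unitary and [spectral_diag A] real; the result does not
   depend on the chosen diagonalization. *)
Definition funcalc (f : R -> R) k (A : 'M[R[i]]_k) : 'M[R[i]]_k :=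
  let P := spectralmx A in
  invmx P
  *m diag_mx (map_mx (fun z => (f (complex.Re z))%:C) (spectral_diag A))
  *m P.

(* [D] is the derivative at [0] of a matrix-valued map of a real variable; the
   library's [is_derive] would need a normed space over [R], whereas
   ['M[R[i]]_k] is one over [R[i]]. *)
Definition is_mxderive0 k (F : R -> 'M[R[i]]_k) (D : 'M[R[i]]_k) : Prop :=
  (h^-1)%:C *: (F h - F 0) @[h --> 0^'] --> D.

Lemma normsqE k (u : 'cV[R[i]]_k) :
  normsq u = \sum_(j < k)
    ((complex.Re (u j ord0)) ^+ 2 + (complex.Im (u j ord0)) ^+ 2).
Proof.
rewrite /normsq /cdot raddf_sum; apply: eq_bigr => j _.
by rewrite -normCK sqr_normc; case: (u j ord0) => a b /=; ring.
Qed.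

Lemma normsq_ge0 k (u : 'cV[R[i]]_k) : 0 <= normsq u.
Proof.
by rewrite normsqE sumr_ge0// => j _; rewrite addr_ge0// sqr_ge0.
Qed.

Lemma normsq_lincomb k (a : R[i]) (u v : 'cV[R[i]]_k) :
  normsq (a *: u + v) <=
  2 * ((complex.Re a) ^+ 2 + (complex.Im a) ^+ 2) * normsq u + 2 * normsq v.
Proof.
rewrite !normsqE !mulr_sumr -big_split/=; apply: ler_sum => j _.
rewrite !mxE; case: a (u j ord0) (v j ord0) => [a1 a2] [u1 u2] [v1 v2] /=.
rewrite -subr_ge0.
rewrite (_ : _ - _ = (a1 * u1 - a2 * u2 - v1) ^+ 2
                   + (a1 * u2 + a2 * u1 - v2) ^+ 2); last by ring.
by rewrite addr_ge0// sqr_ge0.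
Qed.

End FiniteDimensional.

(* Up to isometry, the finite-dimensional Hilbert spaces are the [C^(d n)]. *)
Definition family (R : realType) (d : nat -> nat) : Type :=
  forall n, 'cV[R[i]]_(d n).

HB.instance Definition _ R d := gen_eqMixin (family R d).
HB.instance Definition _ R d := gen_choiceMixin (family R d).

Section FamilyModule.
Variables (R : realType) (d : nat -> nat).
Implicit Types x y z : family R d.

Definition family_zero : family R d := fun n => 0.
Definition family_opp x : family R d := fun n => - x n.
Definition family_add x y : family R d := fun n => x n + y n.
Definition family_scale (a : R[i]) x : family R d := fun n => a *: x n.

Lemma family_addA : associative family_add.
Proof. by move=> x y z; apply: functional_extensionality_dep => n; exact: addrA. Qed.
Lemma family_addC : commutative family_add.
Proof. by move=> x y; apply: functional_extensionality_dep => n; exact: addrC. Qed.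
Lemma family_add0 : left_id family_zero family_add.
Proof. by move=> x; apply: functional_extensionality_dep => n; exact: add0r. Qed.
Lemma family_addN : left_inverse family_zero family_opp family_add.
Proof. by move=> x; apply: functional_extensionality_dep => n; exact: addNr. Qed.

HB.instance Definition _ := GRing.isZmodule.Build (family R d)
  family_addA family_addC family_add0 family_addN.

Lemma family_scaleA a b x :
  family_scale a (family_scale b x) = family_scale (a * b) x.
Proof. by apply: functional_extensionality_dep => n; exact: scalerA. Qed.
Lemma family_scale1 : left_id 1 family_scale.
Proof. by move=> x; apply: functional_extensionality_dep => n; exact: scale1r. Qed.
Lemma family_scaleDr : right_distributive family_scale +%R.
Proof. by move=> a x y; apply: functional_extensionality_dep => n; exact: scalerDr. Qed.
Lemma family_scaleDl x : {morph family_scale^~ x : a b / a + b}.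
Proof. by move=> a b; apply: functional_extensionality_dep => n; exact: scalerDl. Qed.

HB.instance Definition _ := GRing.Zmodule_isLmodule.Build R[i] (family R d)
  family_scaleA family_scale1 family_scaleDr family_scaleDl.

Definition square_summable : {pred family R d} :=
  [pred x : family R d | `[< (\sum_(n <oo) (normsq (x n))%:E < +oo)%E >]].

Lemma square_summableP x :
  reflect (\sum_(n <oo) (normsq (x n))%:E < +oo)%E (x \in square_summable).
Proof. by rewrite inE; exact: asboolP. Qed.

Lemma square_summable_submod : submod_closed square_summable.
Proof.
split=> [|a x y /square_summableP hx /square_summableP hy];
  apply/square_summableP.
  rewrite eseries0// => n _ _; rewrite normsqE big1// => j _.
  by rewrite mxE/= !expr0n/= addr0.
set c := 2 * ((complex.Re a) ^+ 2 + (complex.Im a) ^+ 2).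
have c0 : 0 <= c by rewrite mulr_ge0// addr_ge0// sqr_ge0.
have n0 z n : (0 <= (normsq (z n : 'cV[R[i]]_(d n)))%:E)%E.
  by rewrite lee_fin normsq_ge0.
apply: (@le_lt_trans _ _
    (\sum_(n <oo) (c%:E * (normsq (x n))%:E + 2%:E * (normsq (y n))%:E))%E).
  apply: lee_nneseries => n _; first by move=> _; exact: n0.
  by rewrite -!EFinM -EFinD lee_fin; exact: normsq_lincomb.
rewrite nneseriesD; try by move=> n _ _; rewrite mule_ge0// lee_fin.
rewrite !nneseriesZl; try by move=> n _.
rewrite lte_add_pinfty// lte_mul_pinfty// ?lee_fin//.
Qed.

HB.instance Definition _ :=
  GRing.isSubmodClosed.Build R[i] (family R d) square_summable
    square_summable_submod.

End FamilyModule.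

Section HilbertSum.
Context {R : realType} (d : nat -> nat).

Record hsum := HSum {
  hsum_val : family R d;
  hsum_prop : hsum_val \in @square_summable R d
}.

HB.instance Definition _ := [isSub for hsum_val].
HB.instance Definition _ := [Choice of hsum by <:].
HB.instance Definition _ := [SubChoice_isSubLmodule of hsum by <:].

Definition hsum_component (x : hsum) : forall n, 'cV[R[i]]_(d n) := hsum_val x.
Coercion hsum_component : hsum >-> Funclass.

Definition hdot (x y : hsum) : R[i] :=
  limn (series (fun n => cdot (x n) (y n))).

Definition hnorm (x : hsum) : R :=
  Num.sqrt (fine (\sum_(n <oo) (normsq (x n))%:E)%E).

Definition basis_family (n : nat) (j : 'I_(d n)) : family R d :=
  fun m => \col_(l < d m) ((m == n) && (l == j :> nat))%:R.

Lemma basis_family_summable n j : @basis_family n j \in @square_summable R d.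
Proof.
apply/square_summableP.
rewrite (nneseriesD1 (n := n))//; last by move=> m _; rewrite lee_fin normsq_ge0.
rewrite eseries0 ?adde0 ?ltry// => m _ /= mn.
rewrite normsqE big1// => l _; rewrite mxE (negbTE mn)/=.
by rewrite expr0n/= addr0.
Qed.

(* The standard orthonormal basis, indexed by pairs [(n, j)] with [j < d n]. *)
Definition hbasis n (j : 'I_(d n)) : hsum :=
  HSum (@basis_family_summable n j).

(* A possibly unbounded operator is represented by its graph. *)
Definition hoperator := set (hsum * hsum).

Definition graph_of (T : hsum -> hsum) : hoperator :=
  [set p : hsum * hsum | p.2 = T p.1].

(* The domain consists of the [x] such that the family [T n *m x n] is again
   square summable. *)
Definition dsum_op (T : forall n, 'M[R[i]]_(d n)) : hoperator :=
  [set p : hsum * hsum | forall n, p.2 n = T n *m p.1 n].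

Definition densely_defined (G : hoperator) : Prop :=
  forall (x : hsum) (e : R), 0 < e ->
    exists p, G p /\ hnorm (x - p.1) < e.

Definition adjoint_op (G : hoperator) : hoperator :=
  [set q : hsum * hsum | forall p, G p -> hdot p.2 q.1 = hdot p.1 q.2].

Definition selfadjoint_op (G : hoperator) : Prop :=
  densely_defined G /\ adjoint_op G = G.

Definition bounded_op (T : hsum -> hsum) : Prop :=
  exists M : R, forall x, hnorm (T x) <= M * hnorm x.

(* Over the complex numbers this forces [P] to be self-adjoint; [0 <= z] in
   [R[i]] means that [z] is real and nonnegative. *)
Definition positive_op (P : hsum -> hsum) : Prop :=
  forall x, 0 <= hdot (P x) x.

(* [P = |T| = (T^* T)^(1/2)]: [P] is positive and [P^2 = T^* T]. *)
Definition is_absolute_value (T P : {linear hsum -> hsum}) : Prop :=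
  [/\ bounded_op P, positive_op P &
      forall x y, hdot (P (P x)) y = hdot (T x) (T y)].

(* The trace of a positive operator and the Hilbert-Schmidt norm do not depend
   on the orthonormal basis in which they are computed. *)
Definition postrace (P : hsum -> hsum) : \bar R :=
  (\sum_(n <oo) \sum_(j < d n)
     (complex.Re (hdot (P (hbasis j)) (hbasis j)))%:E)%E.

Definition hs_normsq (T : hsum -> hsum) : \bar R :=
  (\sum_(n <oo) \sum_(j < d n) ((hnorm (T (hbasis j))) ^+ 2)%:E)%E.

Definition trace_class (G : hoperator) : Prop :=
  exists T : {linear hsum -> hsum}, [/\ G = graph_of T, bounded_op T &
    exists2 P : {linear hsum -> hsum},
      is_absolute_value T P & (postrace P < +oo)%E].

Definition hilbert_schmidt (G : hoperator) : Prop :=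
  exists T : {linear hsum -> hsum}, [/\ G = graph_of T, bounded_op T &
    (hs_normsq T < +oo)%E].

End HilbertSum.

(* Main.v *)
From HB Require Import structures.
Require Import Defs.
From mathcomp Require Import all_boot all_order all_algebra.
From mathcomp Require Import all_classical all_reals all_analysis.
From mathcomp.real_closed Require Import complex.
From mathcomp Require Import ring lra.
Import Order.TTheory GRing.Theory Num.Theory.
Import numFieldNormedType.Exports.
Local Open Scope ring_scope.
Local Open Scope classical_set_scope.
Local Open Scope complex_scope.

Set Implicit Arguments.
Unset Strict Implicit.
Unset Printing Implicit Defensive.

(** The second order term of the expansion of [f (A + B)] is a bilinear Schur
    multiplier in [B], whose symbol is the second divided difference of [f].
    Take [A] diagonal with an eigenvalue [0], and [B] supported in the row and
    the column of that eigenvalue, where its off-diagonal entries are all [c].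
    Then for the remaining eigenvalues [x, y] the second order term has the
    entries [c^2 (g x - g y) / (x - y)] with [f x = x g x]: up to [c^2] it is the
    Loewner matrix of [g]. If [g] behaves as the absolute value at infinity, these
    matrices are not bounded as Schur multipliers on the trace class, for the
    absolute value is not operator Lipschitz. This is compatible with a bounded
    second derivative of [f]: here [f x = x sqrt (1 + x^2)] and
    [g x = sqrt (1 + x^2)].

    Quantitatively, let the eigenvalues be [0], [s 2^p] and [- s 2^q] for
    [p, q < N]. For [s] large the block of the second order term between positive
    and negative eigenvalues approaches [c^2 (2^p - 2^q) / (2^p + 2^q)], whose
    entries have the sign of [p - q] and, for distinct [p] and [q], a modulus at
    least [c^2 / 3]. By duality its trace norm is bounded below by pairing it
    with a matrix having the same signs, whose norm is small compared with its
    entries. A dyadic variant of the Hilbert matrix does it ([dyadic_hilbert]):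
    for [N = 2^(m^2)] its moduli add up to [m^2 N] and its norm is [O(m)]
    ([dyadic_hilbert_form_le]). So the trace norm of the second order term is at
    least of order [m N c^2] ([trace_norm_lower]), against [4 N c^2] for the
    square of the Hilbert-Schmidt norm of [B]. With [m = 2^k] and [c^2 N = 2^-k]
    in the [k]-th summand, the latter are summable and the former are bounded
    below.

    The remainder is compared with its second order term by an a priori
    estimate. The matrix [f (A + B)] commutes with [A + B]
    ([remainder_commutator]), which determines its off-diagonal entries in terms
    of lower order ones. Its diagonal entries are means of [f] for spectral
    measures of [A + B] with known mean and variance
    ([funcalc_diag_bound]), so that the bound on the second derivative controls
    them. Both together bound the remainder ([remainder_le]); applied to [t B]
    this gives the derivative, and applied to eigenvalues scaled by [s] it gives
    the second order term up to [O(1 / s)] ([remainder_border]).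

    On the direct sum, the absolute value [P] of a trace class operator maps an
    eigenvector of a block for the eigenvalue [t] to its multiple by [|t|]
    ([positive_sqrt_eigenvector]), so that the trace of [P] is the sum of the
    trace norms of the blocks, which is infinite here. *)

(** * Moduli of complex numbers *)

Section Modulus.
Context {R : realType}.
Implicit Types z : R[i].
Local Notation normc := (@Normc.normc R).

Lemma norm_normc z : `|z| = (normc z)%:C.
Proof. by case: z. Qed.

Lemma normc_ge0 z : 0 <= normc z.
Proof. by rewrite -lecR -norm_normc normr_ge0. Qed.

Lemma normc_real (x : R) : normc x%:C = `|x|.
Proof. by rewrite /= expr0n/= addr0 sqrtr_sqr. Qed.

Lemma normc_sum (I : finType) (F : I -> R[i]) :
  normc (\sum_i F i) <= \sum_i normc (F i).
Proof.
rewrite -lecR -norm_normc rmorph_sum/=.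
apply: le_trans (ler_norm_sum _ _ _) _.
by rewrite le_eqVlt (eq_bigr _ (fun i _ => norm_normc (F i))) eqxx.
Qed.

Lemma mul_conjC z : Num.conj z * z = (normc z ^+ 2)%:C.
Proof. by rewrite mulrC -normCK norm_normc rmorphXn. Qed.

Lemma conj_complex_real (x : R) : Num.conj (x%:C : R[i]) = x%:C.
Proof. exact: conjc_real. Qed.

End Modulus.

(** * Functional calculus of Hermitian matrices *)

Lemma mul_conj_diag (F : comNzRingType) k (P Q : 'M[F]_k) (d e : 'rV[F]_k) :
  P *m Q = 1%:M ->
  (Q *m diag_mx d *m P) *m (Q *m diag_mx e *m P) =
  Q *m diag_mx (\row_j (d ord0 j * e ord0 j)) *m P.
Proof.
move=> PQ; rewrite -!mulmxA (mulmxA P Q) PQ mul1mx; congr (_ *m _).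
by rewrite mulmxA mulmx_diag.
Qed.

Section FunctionalCalculus.
Context {R : realType}.
Local Notation C := R[i].
Local Notation normc := (@Normc.normc R).
Local Open Scope sesquilinear_scope.

Lemma hermsymmxE k (A : 'M[C]_k) : A \is hermsymmx <-> A = A^t*.
Proof.
split=> [/is_hermitianmxP|h]; first by rewrite expr0 scale1r.
by apply/is_hermitianmxP; rewrite expr0 scale1r.
Qed.

Lemma spectral_decomposition k (A : 'M[C]_k) : A \is hermsymmx ->
  exists (P : 'M[C]_k) (m : 'I_k -> R),
    [/\ P *m P^t* = 1%:M, P^t* *m P = 1%:M,
        A = P^t* *m diag_mx (\row_j (m j)%:C) *m P &
        forall f, funcalc f A = P^t* *m diag_mx (\row_j (f (m j))%:C) *m P].
Proof.
move=> hA; have uP := spectral_unitarymx A.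
have PPt : spectralmx A *m (spectralmx A)^t* = 1%:M by apply/unitarymxP.
have dE (f : R -> R) : map_mx (fun z => (f (complex.Re z))%:C) (spectral_diag A) =
    \row_j (f (complex.Re (spectral_diag A ord0 j)))%:C.
  by apply/rowP => j; rewrite !mxE.
have AE : A = (spectralmx A)^t* *m diag_mx
    (\row_j (complex.Re (spectral_diag A ord0 j))%:C) *m spectralmx A.
  have := orthomx_spectralP (hermitian_normalmx hA); rewrite invmx_unitary//.
  suff -> : \row_j (complex.Re (spectral_diag A ord0 j))%:C = spectral_diag A.
    exact: id.
  apply/rowP => j; rewrite mxE RRe_real//.
  exact/mxOverP/hermitian_spectral_diag_real.
exists (spectralmx A), (fun j => complex.Re (spectral_diag A ord0 j)).
split; [exact: PPt|exact: (mulmx1C PPt)|exact: AE|move=> f].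
rewrite /funcalc (invmx_unitary uP) dE; reflexivity.
Qed.

Lemma conj_diagE k (P : 'M[C]_k) (h : 'I_k -> R) i j :
  (P^t* *m diag_mx (\row_l (h l)%:C) *m P) i j =
  \sum_l Num.conj (P l i) * (h l)%:C * P l j.
Proof.
rewrite mul_mx_diag mxE; apply: eq_bigr => l _.
by rewrite !mxE.
Qed.

Lemma funcalc_herm (f : R -> R) k (A : 'M[C]_k) :
  A \is hermsymmx -> funcalc f A \is hermsymmx.
Proof.
move=> /spectral_decomposition[P [m [_ _ _ ->]]]; apply/hermsymmxE.
apply/matrixP => i j; rewrite [in RHS]mxE [in RHS]mxE !conj_diagE rmorph_sum.
apply: eq_bigr => l _. rewrite 2!rmorphM/= conjCK conj_complex_real.
by rewrite -mulrA mulrC; congr (_ * _); exact: mulrC.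
Qed.

Lemma funcalc_comm (f : R -> R) k (A : 'M[C]_k) :
  A \is hermsymmx -> A *m funcalc f A = funcalc f A *m A.
Proof.
move=> /spectral_decomposition[P [m [PPt _ AE ->]]].
rewrite {}AE (mul_conj_diag _ _ PPt) (mul_conj_diag _ _ PPt).
by congr (_ *m diag_mx _ *m _); apply/rowP => j; rewrite !mxE mulrC.
Qed.

(** The diagonal entry of [f A] is the mean of [f] for the spectral
    measure of [A] at a basis vector, whose first two moments are entries of
    [A] and [A^2]: a Taylor estimate of [f] can be integrated against it. *)
Lemma funcalc_diag_bound (f : R -> R) (M a y dy : R) k (A : 'M[C]_k) i :
  A \is hermsymmx -> A i i = a%:C ->
  (forall x, `|f x - y - dy * (x - a)| <= M * (x - a) ^+ 2) ->
  normc (funcalc f A i i - y%:C) <=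
    M * \sum_(j | j != i) normc (A i j) ^+ 2.
Proof.
move=> hA Aii Hf; have [P [m [PPt PtP AE ->]]] := spectral_decomposition hA.
pose w l := normc (P l i) ^+ 2.
have diagE (h : 'I_k -> R) : (P^t* *m diag_mx (\row_l (h l)%:C) *m P) i i
    = (\sum_l h l * w l)%:C.
  rewrite conj_diagE rmorph_sum; apply: eq_bigr => l _.
  by rewrite mulrAC mul_conjC -rmorphM mulrC.
have w1 : \sum_l w l = 1.
  have PtPi : (P^t* *m P) i i = 1 by rewrite PtP mxE eqxx.
  apply: complexI; rewrite rmorph1 -PtPi mxE rmorph_sum; apply: eq_bigr => l _.
  by rewrite !mxE mul_conjC.
have wm : \sum_l m l * w l = a.
  by apply: complexI; rewrite -diagE -AE.
have wm2 : \sum_l m l ^+ 2 * w l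
    = a ^+ 2 + \sum_(j | j != i) normc (A i j) ^+ 2.
  apply: complexI; rewrite -diagE.
  have -> : P^t* *m diag_mx (\row_l (m l ^+ 2)%:C) *m P = A *m A^t*.
    have -> : \row_l (m l ^+ 2)%:C =
        \row_j ((\row_l (m l)%:C) ord0 j * (\row_l (m l)%:C) ord0 j) :> 'rV[C]_k.
      by apply/rowP => j; rewrite !mxE; exact: rmorphM.
    rewrite -(mul_conj_diag _ _ PPt) -AE -(proj1 (hermsymmxE A))//.
  rewrite mxE (bigD1 i)//= rmorphD/= rmorph_sum; congr (_ + _).
    by rewrite !mxE Aii mulrC mul_conjC normc_real real_normK ?num_real.
  by apply: eq_bigr => j _; rewrite !mxE mulrC mul_conjC.
rewrite diagE -rmorphB normc_real.
have -> : \sum_l f (m l) * w l - y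
    = \sum_l (f (m l) - y - dy * (m l - a)) * w l.
  rewrite [RHS](eq_bigr (fun l => f (m l) * w l
     - (y * w l + dy * (m l * w l) - dy * a * w l))); last first.
    by move=> l _; ring.
  rewrite sumrB; congr (_ - _).
  by rewrite sumrB big_split/= -!mulr_sumr w1 wm; ring.
apply: le_trans (ler_norm_sum _ _ _) _.
apply: (@le_trans _ _ (\sum_l M * (m l - a) ^+ 2 * w l)).
  apply: ler_sum => l _; rewrite normrM (ger0_norm (sqr_ge0 _)).
  by rewrite ler_wpM2r ?sqr_ge0.
rewrite le_eqVlt; apply/orP; left; apply/eqP.
rewrite (eq_bigr (fun l => M * (m l ^+ 2 * w l
   - 2 * a * (m l * w l) + a ^+ 2 * w l))); last by move=> l _; ring.
rewrite -mulr_sumr; congr (_ * _).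
by rewrite big_split/= sumrB -!mulr_sumr w1 wm wm2; ring.
Qed.

End FunctionalCalculus.

(** * Commutators and the second order remainder *)

Lemma addB2K (V : zmodType) (x a b : V) : x = a + b + (x - a - b).
Proof. by rewrite -(addrA x) -opprD [RHS]addrC subrK. Qed.

Section Perturbation.
Context {R : realType}.
Local Notation C := R[i].
Local Notation normc := (@Normc.normc R).
Local Open Scope sesquilinear_scope.

Lemma diag_real_herm k (lam : 'I_k -> R) :
  (diag_mx (\row_j (lam j)%:C) : 'M[C]_k) \is hermsymmx.
Proof.
apply/hermsymmxE/matrixP => i j; rewrite !mxE eq_sym rmorphMn/= conj_complex_real.
by case: eqVneq => [->|_].
Qed.

Lemma diag_mulmxE k (a : 'I_k -> C) (X : 'M[C]_k) i j :
  (diag_mx (\row_l a l) *m X) i j = a i * X i j.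
Proof. by rewrite mul_diag_mx !mxE. Qed.

Lemma mulmx_diagE k (a : 'I_k -> C) (X : 'M[C]_k) i j :
  (X *m diag_mx (\row_l a l)) i j = X i j * a j.
Proof. by rewrite mul_mx_diag !mxE. Qed.

(** A unitary matrix intertwining two diagonal matrices has nonzero entries only
    between equal eigenvalues, so that it intertwines their images by [f]. *)
Lemma funcalc_diag (f : R -> R) k (lam : 'I_k -> R) :
  funcalc f (diag_mx (\row_j (lam j)%:C)) = diag_mx (\row_j (f (lam j))%:C).
Proof.
have hA := diag_real_herm lam; set A := diag_mx _ in hA *.
have [P [m [PPt PtP AE ->]]] := spectral_decomposition hA.
have PA : P *m A = diag_mx (\row_j (m j)%:C) *m P.
  by rewrite [in LHS]AE !mulmxA PPt mul1mx.
have Pml l j : (f (m l))%:C * P l j = (f (lam j))%:C * P l j.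
  have := congr1 (fun X : matrix _ _ _ => X l j) PA.
  rewrite /A mulmx_diagE diag_mulmxE mulrC => /eqP.
  rewrite -subr_eq0 -mulrBl mulf_eq0 subr_eq0 => /orP[/eqP/complexI->//|].
  by move=> /eqP->; rewrite !mulr0.
apply/matrixP => i j; rewrite conj_diagE.
transitivity ((f (lam j))%:C * (P^t* *m P) i j).
  rewrite [in RHS]mxE mulr_sumr; apply: eq_bigr => l _.
  by rewrite -mulrA Pml !mxE mulrCA.
by rewrite PtP !mxE; case: eqVneq => [->|_]; [exact: mulr1|exact: mulr0].
Qed.

(** For [x = y] this is [0] and not [f' x]: below it only multiplies entries of
    matrices with zero diagonal. *)
Definition divdiff (f : R -> R) (x y : R) : R := (f x - f y) / (x - y).

(** The Daletskii-Krein formula for the derivative of [t |-> f (A + t B)] at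
    [t = 0], for [A] diagonal and [B] of zero diagonal. *)
Definition schur_divdiff (f : R -> R) k (lam : 'I_k -> R) (B : 'M[C]_k) :=
  \matrix_(i, j) ((divdiff f (lam i) (lam j))%:C * B i j).

Definition remainder (f : R -> R) k (lam : 'I_k -> R) (B : 'M[C]_k) : 'M[C]_k :=
  let A := diag_mx (\row_j (lam j)%:C) in
  funcalc f (A + B) - funcalc f A - schur_divdiff f lam B.

Lemma hermD k (A B : 'M[C]_k) :
  A \is hermsymmx -> B \is hermsymmx -> A + B \is hermsymmx.
Proof.
move=> /hermsymmxE hA /hermsymmxE hB; apply/hermsymmxE/matrixP => i j.
rewrite [in LHS]hA [in LHS]hB !mxE; exact/esym/rmorphD.
Qed.

Lemma hermB k (A B : 'M[C]_k) :
  A \is hermsymmx -> B \is hermsymmx -> A - B \is hermsymmx.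
Proof.
move=> /hermsymmxE hA /hermsymmxE hB; apply/hermsymmxE/matrixP => i j.
rewrite [in LHS]hA [in LHS]hB !mxE; exact/esym/rmorphB.
Qed.

Lemma hermZ_real k (t : R) (B : 'M[C]_k) :
  B \is hermsymmx -> t%:C *: B \is hermsymmx.
Proof.
move=> /hermsymmxE hB; apply/hermsymmxE/matrixP => i j.
by rewrite [in LHS]hB !mxE [in RHS]rmorphM/= conj_complex_real.
Qed.

Lemma schur_divdiff_herm f k (lam : 'I_k -> R) (B : 'M[C]_k) :
  B \is hermsymmx -> schur_divdiff f lam B \is hermsymmx.
Proof.
move=> /hermsymmxE hB; apply/hermsymmxE/matrixP => i j.
rewrite ![in LHS]mxE [in LHS]hB [in RHS]mxE [in RHS]mxE [in RHS]mxE.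
rewrite [in RHS]rmorphM/= conj_complex_real !mxE; congr (_%:C * _).
by rewrite /divdiff -(opprB (f (lam i))) -(opprB (lam i)) invrN mulrNN.
Qed.

Lemma remainder_herm f k (lam : 'I_k -> R) (B : 'M[C]_k) :
  B \is hermsymmx -> remainder f lam B \is hermsymmx.
Proof.
move=> hB; have hA := diag_real_herm lam.
exact: (hermB (hermB (funcalc_herm f (hermD hA hB)) (funcalc_herm f hA))
  (schur_divdiff_herm f lam hB)).
Qed.

(** Since [f (A + B)] commutes with [A + B], its commutator with [A] is its
    commutator with [B] up to sign. For [A] diagonal, dividing by
    [lam i - lam j] turns bounds on [f (A + B)] into bounds of one order more in
    [B] on its off-diagonal entries. *)
Lemma remainder_commutator f k (lam : 'I_k -> R) (B : 'M[C]_k) i j :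
  B \is hermsymmx -> (forall i j, i != j -> lam i != lam j) ->
  i != j ->
  let D := schur_divdiff f lam B in
  let Q := remainder f lam B in
  (lam i - lam j)%:C * Q i j =
  \sum_l (D i l * B l j - B i l * D l j)
  + \sum_l (Q i l * B l j - B i l * Q l j).
Proof.
move=> hB laminj ij D Q.
have hA := diag_real_herm lam; set A := diag_mx _ in hA.
pose F := funcalc f (A + B).
have FM : F = diag_mx (\row_j (f (lam j))%:C) + D + Q.
  rewrite /Q /remainder -/A -/F -/D funcalc_diag; exact: addB2K.
have FE l m : F l m = ((f (lam l))%:C *+ (l == m)) + D l m + Q l m.
  rewrite [in LHS]FM mxE; congr (_ + _).
  by rewrite mxE; congr (_ + _); rewrite !mxE.
have := funcalc_comm f (hermD hA hB).
rewrite -/F; clearbody F Q.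
move=> /(congr1 (fun X : matrix _ _ _ => X i j)).
rewrite mulmxDl mulmxDr mxE [RHS]mxE /A diag_mulmxE mulmx_diagE.
rewrite [(B *m F) i j]mxE [(F *m B) i j]mxE => h.
have Dij : (lam i - lam j)%:C * D i j = (f (lam i) - f (lam j))%:C * B i j.
  rewrite /D mxE mulrA -rmorphM /divdiff mulrCA divff ?mulr1//.
  by rewrite subr_eq0 laminj.
have sumF : \sum_l F i l * B l j - \sum_l B i l * F l j =
    (f (lam i) - f (lam j))%:C * B i j +
  (\sum_l (D i l * B l j - B i l * D l j)
  + \sum_l (Q i l * B l j - B i l * Q l j)).
  have -> : (f (lam i) - f (lam j))%:C * B i j =
     \sum_l ((f (lam i))%:C *+ (i == l) * B l j
             - B i l * ((f (lam l))%:C *+ (l == j))).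
    have s1 : \sum_l (f (lam i))%:C *+ (i == l) * B l j = (f (lam i))%:C * B i j.
      rewrite (bigD1 i)//= eqxx mulr1n big1 ?addr0// => l.
      by rewrite eq_sym => /negbTE ->; rewrite mulr0n mul0r.
    have s2 : \sum_l B i l * ((f (lam l))%:C *+ (l == j)) = (f (lam j))%:C * B i j.
      rewrite (bigD1 j)//= eqxx mulr1n big1 ?addr0 1?mulrC// => l.
      by move=> /negbTE ->; rewrite mulr0n mulr0.
    by rewrite sumrB s1 s2 rmorphB mulrBl.
  rewrite -sumrB -!big_split/=; apply: eq_bigr => l _.
  by rewrite !FE; ring.
move: h sumF; rewrite -Dij (FE i j) (negbTE ij) mulr0n add0r rmorphB.
move: (\sum_l F i l * B l j) (\sum_l B i l * F l j) => s1 s2 h sumF.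
apply: (@addrI _ (((lam i)%:C - (lam j)%:C) * D i j)); rewrite -sumF.
apply/eqP; rewrite -subr_eq0; apply/eqP.
move: h => /eqP; rewrite -subr_eq0 => /eqP <-; ring.
Qed.

End Perturbation.

(** * A priori bounds on the remainder *)

Section RemainderBounds.
Context {R : realType}.
Local Notation C := R[i].
Local Notation normc := (@Normc.normc R).

(** The first order Taylor estimate with a quadratic error uniform in the base
    point: all that the bounds below use of the regularity of [f]. *)
Definition taylor2 (f : R -> R) (M : R) := forall a, exists dy,
  forall x, `|f x - f a - dy * (x - a)| <= M * (x - a) ^+ 2.

Lemma taylor2_ge0 f M : taylor2 f M -> 0 <= M.
Proof.
move=> /(_ 0) [dy /(_ 1)]; rewrite subr0 expr1n !mulr1.
exact: le_trans (normr_ge0 _).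
Qed.

Lemma normc_commutator k (X B : 'M[C]_k) i j (b x : R) :
  (forall i j, normc (B i j) <= b) -> (forall i j, normc (X i j) <= x) ->
  normc (\sum_l (X i l * B l j - B i l * X l j)) <= 2 * k%:R * b * x.
Proof.
move=> Bb Xx; apply: le_trans (normc_sum _) _.
apply: (@le_trans _ _ (\sum_(l < k) 2 * b * x)).
  apply: ler_sum => l _; apply: le_trans (le_normcD _ _) _.
  rewrite normcN !Normc.normcM.
  rewrite (_ : 2 * b * x = x * b + b * x); last by ring.
  by apply: lerD; apply: ler_pM; rewrite ?normc_ge0.
rewrite sumr_const card_ord -mulr_natr; lra.
Qed.

Section Bounds.
Variables (f : R -> R) (M : R) (k : nat) (lam : 'I_k -> R) (B : 'M[C]_k).
Variables (b gap dd : R).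
Hypotheses (fM : taylor2 f M) (hB : B \is hermsymmx) (B0 : forall i, B i i = 0).
Hypotheses (Bb : forall i j, normc (B i j) <= b).
Hypotheses (gap0 : 0 < gap).
Hypotheses (hgap : forall i j, i != j -> gap <= `|lam i - lam j|).
Hypotheses (bgap : 4 * k%:R * b <= gap).
Hypotheses (hdd : forall i j, normc (schur_divdiff f lam B i j) <= dd).

Let lam_inj i j : i != j -> lam i != lam j.
Proof.
move=> /hgap h; rewrite -subr_eq0 -normr_gt0; exact: lt_le_trans gap0 h.
Qed.

Lemma remainder_diag i : normc (remainder f lam B i i) <= M * k%:R * b ^+ 2.
Proof.
have b0 : 0 <= b := le_trans (normc_ge0 _) (Bb i i).
have M0 := taylor2_ge0 fM.
have [dy hdy] := fM (lam i).
have Aii : (diag_mx (\row_j (lam j)%:C) + B) i i = (lam i)%:C.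
  by rewrite !mxE eqxx B0 addr0.
have := funcalc_diag_bound (hermD (diag_real_herm lam) hB) Aii hdy.
have -> : remainder f lam B i i =
    funcalc f (diag_mx (\row_j (lam j)%:C) + B) i i - (f (lam i))%:C.
  rewrite /remainder funcalc_diag; move: (funcalc _ _) => F.
  by rewrite !mxE eqxx B0 mulr0 subr0.
move=> h; apply: le_trans h _.
rewrite -mulrA ler_wpM2l//.
apply: (@le_trans _ _ (\sum_(j | j != i) b ^+ 2)).
  apply: ler_sum => j ji; rewrite !mxE eq_sym (negbTE ji) add0r.
  by rewrite ler_sqr ?nnegrE ?normc_ge0.
rewrite sumr_const -[leLHS]mulr_natl ler_wpM2r ?sqr_ge0// ler_nat.
by apply: leq_trans (max_card _) _; rewrite card_ord.
Qed.

Lemma remainder_offdiag i j r : i != j ->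
  (forall i j, normc (remainder f lam B i j) <= r) ->
  normc (remainder f lam B i j) <= 2 * k%:R * b * (dd + r) / gap.
Proof.
move=> ij hr; rewrite ler_pdivlMr//.
have := remainder_commutator f hB lam_inj ij; move=> /= h.
have hn : normc (remainder f lam B i j) * gap <=
    normc ((lam i - lam j)%:C * remainder f lam B i j).
  by rewrite Normc.normcM normc_real mulrC ler_wpM2r ?normc_ge0// hgap.
apply: le_trans hn _; rewrite h; apply: le_trans (le_normcD _ _) _.
by rewrite mulrDr lerD// normc_commutator.
Qed.

Definition remainder_bound := 2 * (M * k%:R * b ^+ 2 + 2 * k%:R * b * dd / gap).

(** The commutator identity bounds the largest entry [r] by a constant plus a
    fraction of [r] itself, the fraction being at most one half as soon as the
    perturbation is small compared with the spectral gaps. *)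
Lemma remainder_le i j : normc (remainder f lam B i j) <= remainder_bound.
Proof.
have b0 : 0 <= b := le_trans (normc_ge0 _) (Bb i i).
have dd0 : 0 <= dd := le_trans (normc_ge0 _) (hdd i i).
have M0 := taylor2_ge0 fM.
pose r := \big[Num.max/0]_(p : 'I_k * 'I_k) normc (remainder f lam B p.1 p.2).
have hr i' j' : normc (remainder f lam B i' j') <= r.
  exact: (le_bigmax _ (fun p => normc (remainder f lam B p.1 p.2)) (i', j')).
have r0 : 0 <= r := le_trans (normc_ge0 _) (hr i j).
apply: le_trans (hr i j) _.
have c1 : 0 <= M * k%:R * b ^+ 2 by rewrite !mulr_ge0// sqr_ge0.
have c2 : 0 <= 2 * k%:R * b * dd / gap by rewrite !mulr_ge0// invr_ge0 ltW.
suff : r <= M * k%:R * b ^+ 2 + 2 * k%:R * b * dd / gap + r / 2.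
  rewrite /remainder_bound; lra.
apply: bigmax_le => [|[i' j'] _ /=]; first by lra.
have [<-|ij] := eqVneq i' j'.
  have := remainder_diag i'; lra.
have := remainder_offdiag ij hr.
have : 2 * k%:R * b * r / gap <= r / 2.
  rewrite ler_pdivrMr//.
  have := ler_wpM2r r0 bgap; lra.
rewrite mulrDr mulrDl; lra.
Qed.

(** With the remainder itself bounded, the commutator identity determines its
    off-diagonal entries up to one more power of [b / gap]. *)
Lemma remainder_second_order i j : i != j ->
  normc (remainder f lam B i j - (\sum_l (schur_divdiff f lam B i l * B l j
     - B i l * schur_divdiff f lam B l j)) / (lam i - lam j)%:C)
  <= 2 * k%:R * b * remainder_bound / gap.
Proof.
move=> ij; rewrite ler_pdivlMr//.
have /= h := remainder_commutator f hB lam_inj ij.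
have l0 : (lam i - lam j)%:C != 0 :> C.
  by rewrite fmorph_eq0 subr_eq0 lam_inj.
apply: (@le_trans _ _ (normc ((lam i - lam j)%:C * (remainder f lam B i j -
   (\sum_l (schur_divdiff f lam B i l * B l j
     - B i l * schur_divdiff f lam B l j)) / (lam i - lam j)%:C)))).
  by rewrite Normc.normcM normc_real mulrC ler_wpM2r ?normc_ge0// hgap.
rewrite mulrBr h mulrCA divff// mulr1 addrC addKr.
by apply: normc_commutator => // *; exact: remainder_le.
Qed.

End Bounds.
End RemainderBounds.

(** * Derivative of the functional calculus *)

Section Derivative.
Context {R : realType}.
Local Notation C := R[i].
Local Notation normc := (@Normc.normc R).

Lemma normc_bounded k (B : 'M[C]_k) : exists b, forall i j, normc (B i j) <= b.
Proof.
exists (\big[Num.max/0]_(p : 'I_k * 'I_k) normc (B p.1 p.2)) => i j.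
exact: (le_bigmax _ (fun p => normc (B p.1 p.2)) (i, j)).
Qed.

Lemma schur_divdiffZ f k (lam : 'I_k -> R) (B : 'M[C]_k) (t : R) :
  schur_divdiff f lam (t%:C *: B) = t%:C *: schur_divdiff f lam B.
Proof. by apply/matrixP => i j; rewrite !mxE mulrCA. Qed.

(** The a priori bound is homogeneous of degree two in the perturbation, so the
    remainder at [t B] is [O(t^2)]. *)
Lemma mxderive0_funcalc (f : R -> R) M k (lam : 'I_k -> R) (B : 'M[C]_k) gap :
  taylor2 f M -> B \is hermsymmx -> (forall i, B i i = 0) -> 0 < gap ->
  (forall i j, i != j -> gap <= `|lam i - lam j|) ->
  is_mxderive0 (fun t => funcalc f (diag_mx (\row_j (lam j)%:C) + t%:C *: B))
    (schur_divdiff f lam B).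
Proof.
move=> fM hB B0 gap0 hgap.
have [b0 Bb] := normc_bounded B.
have [d0 Dd] := normc_bounded (schur_divdiff f lam B).
set D := schur_divdiff f lam B in Dd *.
set K := 2 * (M * k%:R * b0 ^+ 2 + 2 * k%:R * b0 * d0 / gap).
have remK (h : R) i j : 4 * k%:R * b0 * `|h| <= gap ->
    normc (remainder f lam (h%:C *: B) i j) <= K * h ^+ 2.
  move=> hh.
  have -> : K * h ^+ 2 = remainder_bound M k (`|h| * b0) gap (`|h| * d0).
    by rewrite /remainder_bound /K -(real_normK (num_real h)); ring.
  apply: remainder_le => //.
  - exact: hermZ_real.
  - by move=> l; rewrite mxE B0 mulr0.
  - by move=> l m; rewrite mxE Normc.normcM normc_real ler_wpM2l.
  - by rewrite mulrCA mulrC -mulrA mulrC -mulrA mulrC in hh *; lra.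
  - by move=> l m; rewrite schur_divdiffZ mxE Normc.normcM normc_real ler_wpM2l.
apply/cvg_ballP => e e0.
have [e1 eE] : exists e1 : R, e = e1%:C.
  by exists (complex.Re e); rewrite RRe_real// gtr0_real.
move: e0; rewrite {}eE ltcR => e0.
have K1 : 0 < `|K| + 1 by rewrite ltr_pwDr.
have c1 : 0 < `|4 * k%:R * b0| + 1 by rewrite ltr_pwDr.
near=> h.
have h0 : h != 0 by near: h; exact: nbhs_dnbhs_neq.
have hK : `|h| < e1 / (`|K| + 1).
  by near: h; apply: dnbhs0_lt; rewrite divr_gt0.
have hc : `|h| < gap / (`|4 * k%:R * b0| + 1).
  by near: h; apply: dnbhs0_lt; rewrite divr_gt0.
split; first by rewrite ltcR.
move=> i j.
have hg : 4 * k%:R * b0 * `|h| <= gap.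
  move: hc; rewrite ltr_pdivlMr// => /ltW; apply: le_trans.
  rewrite mulrC ler_wpM2l//; have := ler_norm (4 * k%:R * b0); lra.
rewrite /ball/= -opprB normrN.
have -> : ((h^-1)%:C *: (funcalc f (diag_mx (\row_j0 (lam j0)%:C) + h%:C *: B) -
    funcalc f (diag_mx (\row_j0 (lam j0)%:C) + 0%:C *: B))) i j - D i j
    = (h^-1)%:C * remainder f lam (h%:C *: B) i j.
  rewrite /remainder schur_divdiffZ -/D rmorph0 scale0r addr0.
  move: (funcalc _ _) (funcalc _ _) => X Y; rewrite !mxE [RHS]mulrBr.
  by rewrite [_ * (h%:C * _)]mulrA -rmorphM mulVf// rmorph1 mul1r.
rewrite norm_normc ltcR Normc.normcM normc_real normfV mulrC ltr_pdivrMr ?normr_gt0//.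
apply: le_lt_trans (remK h i j hg) _.
rewrite -(real_normK (num_real h)) expr2 mulrA ltr_pM2r ?normr_gt0//.
move: hK; rewrite ltr_pdivlMr//; apply: le_lt_trans.
rewrite mulrC ler_wpM2l//; have := ler_norm K; lra.
Unshelve. all: by end_near. Qed.

End Derivative.

(** * The function x sqrt(1 + x^2) *)

Section Function.
Context {R : realType}.

(** A smooth even function close to the absolute value at infinity. *)
Definition bracket (x : R) := Num.sqrt (1 + x ^+ 2).
Definition xbracket x := x * bracket x.

Lemma bracket_sqr x : bracket x ^+ 2 = 1 + x ^+ 2.
Proof. by rewrite sqr_sqrtr// addr_ge0// sqr_ge0. Qed.

Lemma bracket_gt0 x : 0 < bracket x.
Proof. by rewrite sqrtr_gt0 ltr_pwDl// sqr_ge0. Qed.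

Lemma bracket_ge1 x : 1 <= bracket x.
Proof. by rewrite -sqrtr1 ler_wsqrtr// lerDl sqr_ge0. Qed.

Lemma bracket_ge x : `|x| <= bracket x.
Proof. by rewrite -sqrtr_sqr ler_wsqrtr// lerDr. Qed.

Lemma bracket_le x : bracket x <= 1 + `|x|.
Proof.
rewrite -ler_sqr ?nnegrE ?(ltW (bracket_gt0 x)) ?addr_ge0//.
rewrite bracket_sqr -(real_normK (num_real x)) sqrrD expr1n.
have := normr_ge0 x; rewrite -mulr_natl; lra.
Qed.

Lemma is_derive_bracket (x : R) : is_derive x (1 : R) bracket (x / bracket x).
Proof.
have p : 0 < 1 + x ^+ 2 by rewrite ltr_pwDl// sqr_ge0.
have h1 : is_derive x (1 : R) (fun y : R => 1 + y ^+ 2) (2 * x).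
  by apply: is_derive_eq; rewrite add0r /GRing.scale/= mulr1; ring.
have h2 := @is_derive1_sqrt _ _ p.
have := @is_derive1_comp _ Num.sqrt (fun y : R => 1 + y ^+ 2) x _ _ h2 h1.
rewrite (_ : _ * (2 * x) = x / bracket x)//.
by rewrite invfM /bracket; field; rewrite gt_eqF ?sqrtr_gt0.
Qed.

Lemma is_derive_xbracket (x : R) :
  is_derive x (1 : R) xbracket (2 * bracket x - (bracket x)^-1).
Proof.
have h := is_derive_bracket x.
have : is_derive x (1:R) (id * bracket) (2 * bracket x - (bracket x)^-1).
  apply: is_derive_eq; rewrite /GRing.scale/= mulr1.
  have /gt_eqF/negbT g0 := bracket_gt0 x.
  have e := bracket_sqr x; apply: (mulfI g0).
  rewrite mulrDr mulrBr divff// mulrCA (mulrCA _ x) divff// mulr1.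
  have : x * x = bracket x * bracket x - 1 by rewrite -!expr2 e; ring.
  lra.
by [].
Qed.

Definition dxbracket (x : R) := 2 * bracket x - (bracket x)^-1.
Definition ddxbracket (x : R) := 2 * (x / bracket x) + x / bracket x ^+ 3.

Lemma is_derive_dxbracket (x : R) : is_derive x (1 : R) dxbracket (ddxbracket x).
Proof.
have h := is_derive_bracket x.
have /gt_eqF/negbT g0 := bracket_gt0 x.
have h' : is_derive x (1 : R) (fun y => (bracket y)^-1) _ := is_deriveV g0 h.
apply: is_derive_eq; rewrite /GRing.scale/= /ddxbracket.
by field.
Qed.

Lemma derive1_xbracket : xbracket^`()%classic = dxbracket.
Proof. by apply/funext => x; rewrite derive1E; have [] := is_derive_xbracket x. Qed.

Lemma derive2_xbracket : xbracket^`(2)%classic = ddxbracket.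
Proof.
rewrite derive1nS /= derive1_xbracket.
by apply/funext => x; rewrite derive1E; have [] := is_derive_dxbracket x.
Qed.

Lemma ddxbracket_bounded x : `|ddxbracket x| <= 3.
Proof.
have g0 := bracket_gt0 x; have g1 := bracket_ge1 x; have gx := bracket_ge x.
have h1 : `|x / bracket x| <= 1.
  by rewrite normrM normfV (gtr0_norm g0) ler_pdivrMr// mul1r.
have h3 : `|x / bracket x ^+ 3| <= 1.
  rewrite normrM normfV (gtr0_norm (exprn_gt0 _ g0)) ler_pdivrMr ?exprn_gt0// mul1r.
  by apply: le_trans gx _; rewrite ler_eXnr.
apply: le_trans (ler_normD _ _) _; rewrite normrM (ger0_norm (ler0n _ 2)); lra.
Qed.

Lemma continuous_bracket : continuous bracket.
Proof.
move=> x; apply: differentiable_continuous.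
by apply/derivable1_diffP; have [] := is_derive_bracket x.
Qed.

Lemma xbracket_C2 : C2_bounded_second_derivative xbracket.
Proof.
split.
- by move=> x; have [] := is_derive_xbracket x.
- by move=> x; rewrite derive1_xbracket; have [] := is_derive_dxbracket x.
- rewrite derive2_xbracket => x.
  have /gt_eqF/negbT g0 := bracket_gt0 x.
  apply: cvgD.
    apply: cvgM; first exact: cvg_cst.
    by apply: cvgM => //; apply: cvgV => //; exact: continuous_bracket.
  apply: cvgM => //; apply: cvgV; first by rewrite expf_neq0.
  by apply: cvgM; [exact: continuous_bracket|apply: cvgM; exact: continuous_bracket].
- by exists 3 => x; rewrite derive2_xbracket; exact: ddxbracket_bounded.
Qed.

Lemma mean_value_bound (f df : R -> R) M (a x : R) :
  (forall y : R, is_derive y (1 : R) f (df y)) ->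
  (forall y : R, `|y - a| <= `|x - a| -> `|df y| <= M) ->
  `|f x - f a| <= M * `|x - a|.
Proof.
move=> fdf dfM.
have fc : continuous f.
  move=> y; apply: differentiable_continuous.
  by apply/derivable1_diffP; have [] := fdf y.
have [ax|xa] := leP a x.
  have [|c] := MVT_segment ax (fun y _ => fdf y).
    exact: continuous_subspaceT.
  rewrite in_itv/= => /andP[ac cx] ->; rewrite normrM ler_wpM2r//.
  by apply: dfM; rewrite !ger0_norm ?subr_ge0// lerB.
have [|c] := MVT_segment (ltW xa) (fun y _ => fdf y).
  exact: continuous_subspaceT.
rewrite in_itv/= => /andP[xc ca].
rewrite distrC => ->; rewrite normrM [`|a - x|]distrC ler_wpM2r//.
by apply: dfM; rewrite distrC [`|x - a|]distrC !ger0_norm ?subr_ge0 ?(ltW xa)// lerB.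
Qed.

Lemma taylor2_xbracket : taylor2 xbracket 3.
Proof.
move=> a; exists (dxbracket a) => x.
have h (y : R) : is_derive y (1 : R)
    (fun z => xbracket z - dxbracket a * z) (dxbracket y - dxbracket a).
  have := is_derive_xbracket y => h.
  by apply: is_derive_eq; rewrite /GRing.scale/= mulr1.
have b (y : R) : `|y - a| <= `|x - a| -> `|dxbracket y - dxbracket a| <= 3 * `|x - a|.
  move=> yx; apply: le_trans (mean_value_bound is_derive_dxbracket
    (fun z _ => ddxbracket_bounded z)) _.
  by rewrite ler_wpM2l.
have := mean_value_bound h b.
rewrite -mulrA -expr2 real_normK ?num_real//.
by congr (`|_| <= _); ring.
Qed.
End Function.

(** * The dyadic Hilbert matrix *)

Section TestMatrix.
Context {R : realType}.

(** This is [2 ^ n], in a form that makes the dyadic matrices block matrices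
    without casts. *)
Fixpoint dyadic_size n : nat :=
  if n is m.+1 then (dyadic_size m + dyadic_size m)%N else 1%N.

(** A dyadic version of the Hilbert matrix [1 / (i - j)]: for distinct
    indices the entry has the sign of [i - j], and [i - j] is replaced in modulus
    by half the size of the smallest dyadic block containing both indices. *)
Fixpoint dyadic_hilbert n : 'M[R]_(dyadic_size n) :=
  match n with
  | 0 => 0
  | m.+1 => block_mx (dyadic_hilbert m) (- const_mx (dyadic_size m)%:R^-1)
                     (const_mx (dyadic_size m)%:R^-1) (dyadic_hilbert m)
  end.

Lemma dyadic_size_gt0 n : (0 < dyadic_size n)%N.
Proof. by elim: n => //= n IH; rewrite addn_gt0 IH. Qed.

Lemma dyadic_hilbert_sign n (i j : 'I_(dyadic_size n)) :
  [/\ (j < i)%N -> 0 <= dyadic_hilbert n i j,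
      (i < j)%N -> dyadic_hilbert n i j <= 0 &
      i = j -> dyadic_hilbert n i j = 0].
Proof.
elim: n i j => [|n IH] i j; first by rewrite mxE.
have c0 : 0 <= (dyadic_size n)%:R^-1 :> R by rewrite invr_ge0.
rewrite /=; case: (split_ordP i) => i' ->; case: (split_ordP j) => j' ->.
- rewrite block_mxEul; have [h1 h2 h3] := IH i' j'; split=> // /lshift_inj; exact: h3.
- rewrite block_mxEur !mxE/=; split.
  + by move=> h; have := ltn_ord i'; rewrite ltnNge (leq_trans (leq_addr _ _) (ltnW h)).
  + by move=> _; rewrite oppr_le0.
  + by move=> /eqP; rewrite eq_lrshift.
- rewrite block_mxEdl !mxE/=; split=> //.
  + by move=> h; have := ltn_ord j'; rewrite ltnNge (leq_trans (leq_addr _ _) (ltnW h)).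
  + by move=> /eqP; rewrite eq_rlshift.
- rewrite block_mxEdr/= !ltn_add2l; have [h1 h2 h3] := IH i' j'.
  by split=> // /rshift_inj; exact: h3.
Qed.

Lemma sum_block_mx (m n : nat) (ul : 'M[R]_m) ur dl (dr : 'M[R]_n)
    (G : R -> 'I_(m + n) -> 'I_(m + n) -> R) :
  \sum_i \sum_j G (block_mx ul ur dl dr i j) i j =
  (\sum_i \sum_j G (ul i j) (lshift n i) (lshift n j)
   + \sum_i \sum_j G (ur i j) (lshift n i) (rshift m j))
  + (\sum_i \sum_j G (dl i j) (rshift m i) (lshift n j)
   + \sum_i \sum_j G (dr i j) (rshift m i) (rshift m j)).
Proof.
rewrite big_split_ord/=; congr (_ + _); rewrite -big_split/=.
  apply: eq_bigr => i _; rewrite big_split_ord/=; congr (_ + _);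
    by apply: eq_bigr => j _; rewrite ?block_mxEul ?block_mxEur.
apply: eq_bigr => i _; rewrite big_split_ord/=; congr (_ + _);
  by apply: eq_bigr => j _; rewrite ?block_mxEdl ?block_mxEdr.
Qed.

Lemma sum_norm_dyadic_hilbert n :
  \sum_i \sum_j `|dyadic_hilbert n i j| = n%:R * (dyadic_size n)%:R.
Proof.
elim: n => [|n IH]; first by rewrite !big_ord1 mxE normr0 mul0r.
have N0 : (dyadic_size n)%:R != 0 :> R by rewrite pnatr_eq0 -lt0n dyadic_size_gt0.
rewrite /= (sum_block_mx _ _ _ _ (fun x _ _ => `|x|)) IH.
have c1 : \sum_(i < dyadic_size n) \sum_(j < dyadic_size n)
    `|(const_mx (dyadic_size n)%:R^-1 : 'M[R]_(dyadic_size n)) i j| = (dyadic_size n)%:R.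
  rewrite (eq_bigr (fun=> 1)); first by rewrite sumr_const card_ord.
  move=> i _; rewrite (eq_bigr (fun=> (dyadic_size n)%:R^-1)).
    by rewrite sumr_const card_ord -[LHS]mulr_natl divff.
  by move=> j _; rewrite mxE ger0_norm ?invr_ge0.
have c2 : \sum_(i < dyadic_size n) \sum_(j < dyadic_size n)
    `|(- const_mx (dyadic_size n)%:R^-1 : 'M[R]_(dyadic_size n)) i j| = (dyadic_size n)%:R.
  rewrite -[RHS]c1; apply: eq_bigr => i _; apply: eq_bigr => j _.
  by rewrite mxE normrN.
by rewrite c1 c2 natrD -[n.+1%:R]natr1; ring.
Qed.

Lemma sqr_sum_le (I : finType) (u : I -> R) :
  (\sum_i u i) ^+ 2 <= #|I|%:R * \sum_i u i ^+ 2.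
Proof.
have : 0 <= \sum_i \sum_j (u i - u j) ^+ 2.
  by apply: sumr_ge0 => i _; apply: sumr_ge0 => j _; exact: sqr_ge0.
have -> : \sum_i \sum_j (u i - u j) ^+ 2 =
    2 * (#|I|%:R * \sum_i u i ^+ 2 - (\sum_i u i) ^+ 2).
  pose S := \sum_i u i; pose Q := \sum_i u i ^+ 2.
  rewrite (eq_bigr (fun i => #|I|%:R * u i ^+ 2 + Q - 2 * S * u i)).
    rewrite sumrB big_split/= sumr_const -[_ *+ #|_|]mulr_natl -!mulr_sumr -/S -/Q.
    ring.
  move=> i _; rewrite (eq_bigr (fun j => u i ^+ 2 + u j ^+ 2 - 2 * u i * u j)).
    rewrite sumrB big_split/= sumr_const -[_ *+ #|_|]mulr_natl -!mulr_sumr -/S -/Q.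
    ring.
  by move=> j _; ring.
lra.
Qed.

(** On a dyadic block the term coupling the two halves is a combination of
    products of a sum over the block with a Haar difference. Weigh each product
    by [tau]: the squared differences are absorbed by the second summand of the
    left-hand side, which passes from the halves to the block by the
    parallelogram law, and by Cauchy-Schwarz the squared sums cost
    [1 / (2 tau)] at each of the [n] levels. *)
Lemma dyadic_hilbert_form (tau : R) n (u v : 'I_(dyadic_size n) -> R) : 0 < tau ->
  `|\sum_i \sum_j dyadic_hilbert n i j * u i * v j|
   + tau / 2 / (dyadic_size n)%:R * ((\sum_i u i) ^+ 2 + (\sum_i v i) ^+ 2)
  <= (tau / 2 + n%:R / (2 * tau)) * (\sum_i u i ^+ 2 + \sum_i v i ^+ 2).
Proof.
move=> tau0; elim: n u v => [|n IH] u v.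
  by rewrite !big_ord1 mxE !mul0r normr0 add0r addr0 divr1.
pose u0 i := u (lshift _ i); pose u1 i := u (rshift _ i).
pose v0 i := v (lshift _ i); pose v1 i := v (rshift _ i).
set N : R := (dyadic_size n)%:R in IH *.
have N0 : 0 < N by rewrite ltr0n dyadic_size_gt0.
have b : \sum_i \sum_j dyadic_hilbert n.+1 i j * u i * v j =
   \sum_i \sum_j dyadic_hilbert n i j * u0 i * v0 j
   + \sum_i \sum_j dyadic_hilbert n i j * u1 i * v1 j
   + N^-1 * ((\sum_i u1 i) * (\sum_i v0 i) - (\sum_i u0 i) * (\sum_i v1 i)).
  rewrite /= (sum_block_mx _ _ _ _ (fun x i j => x * u i * v j)).
  have e (c : R) (w z : 'I_(dyadic_size n) -> R) : \sum_i \sum_j c * w i * z j =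
      c * ((\sum_i w i) * (\sum_j z j)).
    rewrite big_distrlr/= mulr_sumr; apply: eq_bigr => i _.
    by rewrite mulr_sumr; apply: eq_bigr => j _; rewrite mulrA.
  have -> : \sum_i \sum_j (- const_mx N^-1 : 'M[R]_(dyadic_size n)) i j
      * u (lshift (dyadic_size n) i) * v (rshift (dyadic_size n) j)
      = - N^-1 * ((\sum_i u0 i) * (\sum_i v1 i)).
    by rewrite -e; apply: eq_bigr => i _; apply: eq_bigr => j _; rewrite !mxE.
  have -> : \sum_i \sum_j (const_mx N^-1 : 'M[R]_(dyadic_size n)) i j
      * u (rshift (dyadic_size n) i) * v (lshift (dyadic_size n) j)
      = N^-1 * ((\sum_i u1 i) * (\sum_i v0 i)).
    by rewrite -e; apply: eq_bigr => i _; apply: eq_bigr => j _; rewrite !mxE.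
  rewrite /u0 /u1 /v0 /v1; ring.
have cs (w z : 'I_(dyadic_size n) -> R) :
    N^-1 * ((\sum_i w i) ^+ 2 + (\sum_i z i) ^+ 2) <= \sum_i w i ^+ 2 + \sum_i z i ^+ 2.
  rewrite mulrC ler_pdivrMr// mulrC mulrDr.
  by have := sqr_sum_le w; have := sqr_sum_le z; rewrite card_ord -/N; lra.
have := IH u0 v0; have := IH u1 v1; have := cs u0 v0; have := cs u1 v1.
rewrite b /= natrD -/N !big_split_ord/= -/(u0 _).
rewrite -[n.+1%:R]natr1.
move: (\sum_i \sum_j _ * u0 i * v0 j) (\sum_i \sum_j _ * u1 i * v1 j) => b0 b1.
rewrite /u0 /u1 /v0 /v1.
move: (\sum_i u (lshift _ i)) (\sum_i u (rshift _ i)) => p q.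
move: (\sum_i v (lshift _ i)) (\sum_i v (rshift _ i)) => r s.
move: (\sum_i u (lshift _ i) ^+ 2) (\sum_i u (rshift _ i) ^+ 2) => U0 U1.
move: (\sum_i v (lshift _ i) ^+ 2) (\sum_i v (rshift _ i) ^+ 2) => V0 V1.
move: n%:R => c cs1 cs0 h1 h0.
have w0 : 0 < N^-1 by rewrite invr_gt0.
have t0 : 0 < tau^-1 by rewrite invr_gt0.
have amgm (x y : R) : `|x * y| <= tau / 2 * x ^+ 2 + tau^-1 / 2 * y ^+ 2.
  have e1 : tau / 2 * x ^+ 2 + tau^-1 / 2 * y ^+ 2 - x * y =
      tau^-1 / 2 * (tau * x - y) ^+ 2 by field; rewrite gt_eqF.
  have e2 : tau / 2 * x ^+ 2 + tau^-1 / 2 * y ^+ 2 + x * y =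
      tau^-1 / 2 * (tau * x + y) ^+ 2 by field; rewrite gt_eqF.
  rewrite ler_norml; apply/andP; split; rewrite -subr_ge0.
    rewrite opprK addrC e2; apply: mulr_ge0 (sqr_ge0 _); lra.
  rewrite e1; apply: mulr_ge0 (sqr_ge0 _); lra.
(* [q r - p s] in terms of the sums and differences over the two halves *)
have cross : `|N^-1 * (q * r - p * s)| <= N^-1 / 2 *
    (tau / 2 * ((q - p) ^+ 2 + (s - r) ^+ 2)
     + tau^-1 / 2 * ((p + q) ^+ 2 + (r + s) ^+ 2)).
  have -> : N^-1 * (q * r - p * s) =
      N^-1 / 2 * ((q - p) * (r + s) - (s - r) * (p + q)) by field; rewrite gt_eqF.
  rewrite normrM gtr0_norm; last by rewrite divr_gt0.
  rewrite ler_wpM2l//; first by rewrite ltW// divr_gt0.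
  apply: le_trans (ler_normB _ _) _.
  have := amgm (q - p) (r + s); have := amgm (s - r) (p + q); lra.
have sq : N^-1 / 2 * (tau^-1 / 2 * ((p + q) ^+ 2 + (r + s) ^+ 2)) <=
    tau^-1 / 2 * (U0 + V0 + (U1 + V1)).
  rewrite mulrCA ler_wpM2l//; first by rewrite ltW// divr_gt0.
  apply: le_trans (lerD cs0 cs1).
  have := mulr_ge0 (ltW w0) (sqr_ge0 (p - q)).
  have := mulr_ge0 (ltW w0) (sqr_ge0 (r - s)); lra.
have -> : tau / 2 / (N + N) * ((p + q) ^+ 2 + (r + s) ^+ 2) =
    tau / 2 / N * (p ^+ 2 + r ^+ 2) + tau / 2 / N * (q ^+ 2 + s ^+ 2)
    - N^-1 / 2 * (tau / 2 * ((q - p) ^+ 2 + (s - r) ^+ 2)).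
  by rewrite (_ : N + N = 2 * N); [field; rewrite gt_eqF|ring].
have -> : (tau / 2 + (c + 1) / (2 * tau)) * (U0 + U1 + (V0 + V1)) =
    (tau / 2 + c / (2 * tau)) * (U0 + V0) + (tau / 2 + c / (2 * tau)) * (U1 + V1)
    + tau^-1 / 2 * (U0 + V0 + (U1 + V1)).
  by field; rewrite gt_eqF.
have := ler_normD (b0 + b1) (N^-1 * (q * r - p * s)); have := ler_normD b0 b1.
move: cross; rewrite mulrDr; lra.
Qed.

(** Taking [tau = m] for [n = m^2] balances the bound: the form has norm
    [O(m)], whereas the moduli of its entries add up to [m^2] times the size of
    the matrix. *)
Lemma dyadic_hilbert_form_le m (u v : 'I_(dyadic_size (m ^ 2)) -> R) : (0 < m)%N ->
  `|\sum_i \sum_j dyadic_hilbert (m ^ 2) i j * u i * v j| <=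
  m%:R * (\sum_i u i ^+ 2 + \sum_i v i ^+ 2).
Proof.
move=> m0; have m0' : 0 < m%:R :> R by rewrite ltr0n.
have := dyadic_hilbert_form u v m0'.
have -> : m%:R / 2 + (m ^ 2)%:R / (2 * m%:R) = m%:R :> R.
  by rewrite natrX; field; rewrite gt_eqF.
apply: le_trans; rewrite lerDl mulr_ge0 ?addr_ge0 ?sqr_ge0//.
Qed.

End TestMatrix.

(** * Bordered diagonal matrices *)

Section Block.
Context {R : realType}.
Local Notation C := R[i].
Local Notation normc := (@Normc.normc R).
Local Open Scope sesquilinear_scope.
Variable N : nat.

Definition pos_index (p : 'I_N) : 'I_(N + N).+1 := lift ord0 (lshift N p).
Definition neg_index (q : 'I_N) : 'I_(N + N).+1 := lift ord0 (rshift N q).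

Lemma block_index_ind (Q : 'I_(N + N).+1 -> Prop) :
  Q ord0 -> (forall p, Q (pos_index p)) -> (forall q, Q (neg_index q)) ->
  forall i, Q i.
Proof.
move=> Q0 Qp Qn i; case: (unliftP ord0 i) => [k ->|-> //].
by case: (split_ordP k) => j ->; [exact: Qp|exact: Qn].
Qed.

Lemma sum_block_index (V : nmodType) (F : 'I_(N + N).+1 -> V) :
  \sum_i F i = F ord0 + (\sum_p F (pos_index p) + \sum_q F (neg_index q)).
Proof. by rewrite big_ord_recl big_split_ord. Qed.

(** The eigenvalue [0] makes the divided differences of [xbracket] along the border
    equal to [bracket]; the geometric progressions keep the ratios
    [(x - y) / (x + y)] of two distinct moduli [x > y] away from [0]. *)
Definition spectrum (s : R) (i : 'I_(N + N).+1) : R :=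
  if unlift ord0 i is Some k then
    match @fintype.split N N k with inl p => s * 2 ^+ p | inr q => - (s * 2 ^+ q) end
  else 0.

Lemma spectrum0 s : spectrum s ord0 = 0.
Proof. by rewrite /spectrum unlift_none. Qed.

Lemma spectrum_pos s p : spectrum s (pos_index p) = s * 2 ^+ p.
Proof. by rewrite /spectrum liftK (unsplitK (inl p)). Qed.

Lemma spectrum_neg s q : spectrum s (neg_index q) = - (s * 2 ^+ q).
Proof. by rewrite /spectrum liftK (unsplitK (inr q)). Qed.

Lemma exp2_gap (p q : nat) : p != q -> 1 <= `|2 ^+ p - 2 ^+ q : R|.
Proof.
wlog : p q / (p < q)%N.
  move=> h pq; move: (pq); rewrite neq_ltn => /orP[] pq'; first exact: h.
  by rewrite distrC; apply: h; rewrite // eq_sym.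
move=> pq _; rewrite distrC -(subnKC (ltnW pq)) exprD.
have h1 : 1 <= 2 ^+ p :> R by rewrite exprn_ege1// ler1n.
have h2 : 2 <= 2 ^+ (q - p) :> R by rewrite ler_eXnr// ?subn_gt0// ler1n.
rewrite ger0_norm; nra.
Qed.

Lemma spectrum_gap (s : R) i j : 0 < s -> i != j ->
  s <= `|spectrum s i - spectrum s j|.
Proof.
move=> s0.
have e1 (p : nat) : 1 <= 2 ^+ p :> R by rewrite exprn_ege1// ler1n.
have sp (p : nat) : s <= s * 2 ^+ p by rewrite ler_peMr// ltW.
have sg (p q : nat) : p != q -> s <= `|s * 2 ^+ p - s * 2 ^+ q|.
  by move=> /exp2_gap h; rewrite -mulrBr normrM gtr0_norm// ler_peMr// ltW.
elim/block_index_ind: i => [|p|p]; elim/block_index_ind: j => [|q|q];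
  rewrite ?spectrum0 ?spectrum_pos ?spectrum_neg ?eqxx// => ij.
- rewrite sub0r normrN ger0_norm//; have := sp q; lra.
- rewrite sub0r opprK ger0_norm//; have := sp q; lra.
- rewrite subr0 ger0_norm//; have := sp p; lra.
- by apply: sg; apply: contraNneq ij => /ord_inj ->.
- rewrite opprK ger0_norm//; have := sp p; have := sp q; lra.
- rewrite subr0 normrN ger0_norm//; have := sp p; lra.
- rewrite -opprD normrN ger0_norm//; have := sp p; have := sp q; lra.
- rewrite opprK addrC; apply: sg; apply: contraNneq ij => /ord_inj ->//.
Qed.

Lemma spectrum_le s i : 0 <= s -> `|spectrum s i| <= s * 2 ^+ N.
Proof.
move=> s0; have e (p : 'I_N) : `|s * 2 ^+ p| <= s * 2 ^+ N.
  rewrite ger0_norm ?mulr_ge0 ?exprn_ge0// ler_wpM2l// ler_weXn2l ?ler1n//.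
  exact/ltnW/ltn_ord.
elim/block_index_ind: i => [|p|q].
- by rewrite spectrum0 normr0 mulr_ge0 ?exprn_ge0.
- by rewrite spectrum_pos.
- by rewrite spectrum_neg normrN.
Qed.

(** [c] times the adjacency matrix of the star centred at the index [0]. *)
Definition border (c : R) : 'M[C]_((N + N).+1) :=
  \matrix_(i, j) (c *+ ((i == ord0) != (j == ord0)))%:C.

Lemma border_herm c : border c \is hermsymmx.
Proof.
apply/hermsymmxE/matrixP => i j; rewrite !mxE conj_complex_real.
by rewrite [(i == ord0) == _]eq_sym.
Qed.

Lemma border_diag c i : border c i i = 0.
Proof. by rewrite mxE eqxx mulr0n. Qed.

Lemma border_far c i j : i != ord0 -> j != ord0 -> border c i j = 0.
Proof. by move=> /negbTE i0 /negbTE j0; rewrite mxE i0 j0 mulr0n. Qed.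

Lemma border_le c i j : 0 <= c -> normc (border c i j) <= c.
Proof.
move=> c0; rewrite mxE normc_real.
by case: (_ != _); rewrite ?mulr0n ?normr0// mulr1n ger0_norm.
Qed.

Lemma border_normsq c : \sum_i \sum_j normc (border c i j) ^+ 2 = 4 * N%:R * c ^+ 2.
Proof.
rewrite sum_block_index.
have e i j : normc (border c i j) ^+ 2 = c ^+ 2 *+ ((i == ord0) != (j == ord0)).
  rewrite mxE normc_real real_normK ?num_real//.
  by case: (_ != _); rewrite ?mulr1n// mulr0n expr0n.
have -> : \sum_j normc (border c ord0 j) ^+ 2 = 2 * N%:R * c ^+ 2.
  rewrite sum_block_index e eqxx mulr0n add0r.
  rewrite (eq_bigr (fun=> c ^+ 2)) => [|p _]; last by rewrite e.
  rewrite [X in _ + X](eq_bigr (fun=> c ^+ 2)) => [|p _]; last by rewrite e.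
  by rewrite !sumr_const card_ord -[c ^+ 2 *+ N]mulr_natl; ring.
have r i : i != ord0 -> \sum_j normc (border c i j) ^+ 2 = c ^+ 2.
  move=> /negbTE i0; rewrite sum_block_index e i0 eqxx mulr1n.
  by rewrite !big1 ?addr0// => p _; rewrite e i0.
rewrite (eq_bigr (fun=> c ^+ 2)) => [|p _]; last by rewrite r.
rewrite [X in _ + (_ + X)](eq_bigr (fun=> c ^+ 2)) => [|p _]; last by rewrite r.
by rewrite !sumr_const card_ord -[c ^+ 2 *+ N]mulr_natl; ring.
Qed.

Lemma divdiff_xbracket_x0 x : x != 0 :> R -> divdiff xbracket x 0 = bracket x.
Proof. by move=> x0; rewrite /divdiff /xbracket mul0r !subr0 mulrC mulKf. Qed.

Lemma divdiff_xbracket_0x x : x != 0 :> R -> divdiff xbracket 0 x = bracket x.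
Proof.
by move=> x0; rewrite /divdiff /xbracket mul0r !sub0r invrN mulrNN mulrC mulKf.
Qed.

Lemma spectrum_neq0 s i : 0 < s -> i != ord0 -> spectrum s i != 0.
Proof.
move=> s0 /(spectrum_gap s0); rewrite spectrum0 subr0 -normr_gt0.
exact: lt_le_trans.
Qed.

Lemma schur_border_le c s i j : 0 <= c -> 1 <= s ->
  normc (schur_divdiff xbracket (spectrum s) (border c) i j) <= (1 + 2 ^+ N) * s * c.
Proof.
move=> c0 s1; have s0 : 0 < s by lra.
have p0 : 0 <= (1 + 2 ^+ N) * s * c by rewrite !mulr_ge0 ?addr_ge0 ?exprn_ge0// ltW.
have gle l : bracket (spectrum s l) <= (1 + 2 ^+ N) * s.
  apply: le_trans (bracket_le _) _; have := spectrum_le l (ltW s0); lra.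
rewrite mxE Normc.normcM normc_real.
have [i0|i0] := eqVneq i ord0; have [j0|j0] := eqVneq j ord0.
- by rewrite mxE i0 j0 eqxx mulr0n Normc.normc0 mulr0.
- rewrite i0 spectrum0 divdiff_xbracket_0x ?spectrum_neq0//.
  by rewrite gtr0_norm ?bracket_gt0// ler_pM ?normc_ge0 ?border_le// ltW// bracket_gt0.
- rewrite j0 spectrum0 divdiff_xbracket_x0 ?spectrum_neq0//.
  by rewrite gtr0_norm ?bracket_gt0// ler_pM ?normc_ge0 ?border_le// ltW// bracket_gt0.
- by rewrite mxE (negbTE i0) (negbTE j0) mulr0n Normc.normc0 mulr0.
Qed.

(** As [bracket] is even, this is its divided difference at the eigenvalues
    [s 2^p] and [- s 2^q]; it tends to [(2^p - 2^q) / (2^p + 2^q)] as [s] goes to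
    infinity. *)
Definition loewner_kernel s (p q : nat) : R :=
  (bracket (s * 2 ^+ p) - bracket (s * 2 ^+ q)) / (s * (2 ^+ p + 2 ^+ q)).

(** At second order the only path between the two indices through entries of the border
    goes via the index [0]. *)
Lemma remainder_border c s (p q : 'I_N) :
  0 <= c -> 1 <= s -> 4 * (N + N).+1%:R * c <= s ->
  normc (remainder xbracket (spectrum s) (border c) (pos_index p) (neg_index q)
         - (c ^+ 2 * loewner_kernel s p q)%:C) <=
  4 * (N + N).+1%:R ^+ 2 * c ^+ 3 * (3 + 2 * (1 + 2 ^+ N)) / s.
Proof.
move=> c0 s1 sc; have s0 : 0 < s by lra.
have pq : pos_index p != neg_index q by rewrite (inj_eq (@lift_inj _ _)) eq_lrshift.
have := remainder_second_order taylor2_xbracket (border_herm c) (border_diag c)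
  (fun i j => border_le i j c0) s0 (fun i j => @spectrum_gap s i j s0) sc
  (fun i j => schur_border_le i j c0 s1) pq.
have -> : \sum_l (schur_divdiff xbracket (spectrum s) (border c) (pos_index p) l
       * border c l (neg_index q) - border c (pos_index p) l
       * schur_divdiff xbracket (spectrum s) (border c) l (neg_index q)) =
   (c ^+ 2 * (bracket (s * 2 ^+ p) - bracket (s * 2 ^+ q)))%:C.
  rewrite (bigD1 ord0)//= big1 ?addr0 => [|l l0]; last first.
    by rewrite (border_far _ l0)// (border_far _ _ l0)// mulr0 mul0r subr0.
  rewrite !mxE/= spectrum0 spectrum_pos spectrum_neg !mulr1n.
  rewrite divdiff_xbracket_x0 ?divdiff_xbracket_0x; last 2 first.
  - by rewrite oppr_eq0 mulf_neq0 ?expf_neq0 ?gt_eqF.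
  - by rewrite mulf_neq0 ?expf_neq0 ?gt_eqF.
  rewrite -!rmorphM -rmorphB; congr (_%:C).
  by rewrite /bracket sqrrN; ring.
rewrite -fmorphV -rmorphM spectrum_pos spectrum_neg opprK -mulrDr.
rewrite -(mulrA (c ^+ 2)) -/(loewner_kernel s p q) => h; apply: le_trans h _.
rewrite /remainder_bound le_eqVlt; apply/orP; left; apply/eqP.
by field; rewrite gt_eqF.
Qed.

Lemma loewner_kernel_ge s (p q : nat) : 2 <= s -> (q < p)%N ->
  1 / 4 <= loewner_kernel s p q.
Proof.
move=> s2 qp; rewrite /loewner_kernel.
have b1 : 1 <= 2 ^+ q :> R by rewrite exprn_ege1// ler1n.
have ab : 2 * 2 ^+ q <= 2 ^+ p :> R by rewrite -exprS ler_weXn2l// ler1n.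
set a : R := 2 ^+ p in ab *; set b : R := 2 ^+ q in b1 ab *.
have sb : 2 <= s * b by nra.
have sa : 2 * (s * b) <= s * a by nra.
have d0 : 0 < s * (a + b) by nra.
rewrite ler_pdivlMr//.
have x2 := bracket_sqr (s * a); have y2 := bracket_sqr (s * b).
have xu := bracket_le (s * a); have yv := bracket_le (s * b).
have x0 := bracket_gt0 (s * a); have y0 := bracket_gt0 (s * b).
rewrite !ger0_norm in xu yv; [|lra|lra].
rewrite [s * (a + b)]mulrDr.
set x := bracket (s * a) in x2 xu x0 *; set y := bracket (s * b) in y2 yv y0 *.
set u := s * a in sa x2 xu *; set v := s * b in sb sa y2 yv *.
rewrite leNgt; apply/negP => lt.
have h1 : (x - y) * (x + y) < 1 / 4 * (u + v) * (x + y) by rewrite ltr_pM2r//; lra.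
have h2 : 1 / 4 * (u + v) * (x + y) <= 1 / 4 * (u + v) * (2 + u + v).
  by rewrite ler_wpM2l//; lra.
have h3 : 1 / 4 * (u + v) * (2 + u + v) <= (u + v) * (u - v).
  by rewrite mulrAC [leLHS]mulrC ler_wpM2l//; lra.
have e : (u + v) * (u - v) = (x - y) * (x + y) by move: x2 y2; rewrite !expr2; lra.
by have := lt_le_trans h1 (le_trans h2 h3); rewrite e ltxx.
Qed.

Lemma loewner_kernelC s (p q : nat) : loewner_kernel s q p = - loewner_kernel s p q.
Proof. by rewrite /loewner_kernel -mulNr opprB [_ ^+ q + _]addrC. Qed.

End Block.

(** * Trace norm of the remainder *)

Section TraceNorm.
Context {R : realType}.
Local Notation C := R[i].
Local Notation normc := (@Normc.normc R).
Local Notation Re := (@complex.Re R).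
Local Notation Im := (@complex.Im R).
Local Open Scope sesquilinear_scope.

Lemma normr_Re_le (z : C) : `|Re z| <= normc z.
Proof. by rewrite -lecR -norm_normc normc_ge_Re. Qed.

Lemma normc_sqr (z : C) : normc z ^+ 2 = Re z ^+ 2 + Im z ^+ 2.
Proof. by case: z => a b /=; rewrite sqr_sqrtr// addr_ge0 ?sqr_ge0. Qed.

Lemma unitary_row_normsq k (P : 'M[C]_k) l :
  P *m P^t* = 1%:M -> \sum_i normc (P l i) ^+ 2 = 1.
Proof.
move=> PPt; apply: complexI; rewrite rmorph_sum rmorph1.
have <- : (P *m P^t*) l l = 1 by rewrite PPt mxE eqxx.
by rewrite mxE; apply: eq_bigr => i _; rewrite !mxE [RHS]mulrC mul_conjC.
Qed.

Lemma Re_conj_diag k (P : 'M[C]_k) (t : 'I_k -> R) i j :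
  Re ((P^t* *m diag_mx (\row_l (t l)%:C) *m P) i j) =
  \sum_l t l * (Re (P l i) * Re (P l j) + Im (P l i) * Im (P l j)).
Proof.
rewrite conj_diagE raddf_sum; apply: eq_bigr => l _.
by case: (P l i) (P l j) => a b [a' b'] /=; ring.
Qed.

(** Trace duality: in an eigenbasis of [X] the pairing is a sum over the
    eigenvalues of values of the dyadic form at the eigenvectors. The form being
    real, it is estimated on their real and imaginary parts. *)
Lemma dyadic_hilbert_pairing m (P : 'M[C]_((dyadic_size (m ^ 2) + dyadic_size (m ^ 2)).+1)) t
    (X := P^t* *m diag_mx (\row_l (t l)%:C) *m P) :
  (0 < m)%N -> P *m P^t* = 1%:M ->
  \sum_p \sum_q dyadic_hilbert (m ^ 2) p q * Re (X (pos_index p) (neg_index q))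
  <= m%:R * \sum_l `|t l|.
Proof.
move=> m0 PPt; set V := dyadic_hilbert _; set N := dyadic_size _ in P t X PPt V *.
pose b (u v : 'I_N -> R) := \sum_p \sum_q V p q * u p * v q.
have -> : \sum_p \sum_q V p q * Re (X (pos_index p) (neg_index q)) =
    \sum_l t l * (b (fun p => Re (P l (pos_index p))) (fun q => Re (P l (neg_index q)))
                + b (fun p => Im (P l (pos_index p))) (fun q => Im (P l (neg_index q)))).
  rewrite (eq_bigr (fun p => \sum_l \sum_q V p q * (t l *
     (Re (P l (pos_index p)) * Re (P l (neg_index q)) +
      Im (P l (pos_index p)) * Im (P l (neg_index q)))))); last first.
    move=> p _; rewrite exchange_big; apply: eq_bigr => q _.
    by rewrite /X Re_conj_diag mulr_sumr.
  rewrite exchange_big; apply: eq_bigr => l _.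
  rewrite /b -big_split mulr_sumr; apply: eq_bigr => p _.
  rewrite -big_split mulr_sumr; apply: eq_bigr => q _ /=; ring.
rewrite mulr_sumr; apply: ler_sum => l _.
apply: le_trans (ler_norm _) _; rewrite normrM mulrC ler_wpM2r//.
apply: le_trans (ler_normD _ _) _.
have hb (u v : 'I_N -> R) : `|b u v| <= m%:R * (\sum_p u p ^+ 2 + \sum_q v q ^+ 2).
  exact: dyadic_hilbert_form_le.
apply: le_trans (lerD (hb _ _) (hb _ _)) _.
rewrite -mulrDr -[leRHS]mulr1 ler_wpM2l//.
rewrite -(unitary_row_normsq l PPt) sum_block_index.
have e (ix : 'I_N -> 'I_((N + N).+1)) : \sum_p normc (P l (ix p)) ^+ 2 =
    \sum_p Re (P l (ix p)) ^+ 2 + \sum_p Im (P l (ix p)) ^+ 2.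
  by rewrite -big_split; apply: eq_bigr => p _; exact: normc_sqr.
rewrite !e; have := sqr_ge0 (normc (P l ord0)); lra.
Qed.

(** The dyadic Hilbert matrix has the signs of the leading part of the
    remainder, so their pairing is at least a multiple of
    [c^2 m^2 N]; dividing by the norm [O(m)] of the test matrix leaves a factor
    [m] more than the square of the Hilbert-Schmidt norm of the border. The scale
    [s] makes the error, which is [O(1 / s)], at most half of the leading part. *)
Lemma trace_norm_lower m (c : R) (N := dyadic_size (m ^ 2)) : (0 < m)%N -> 0 < c ->
  exists2 s : R, 0 < s & forall (P : 'M[C]_((N + N).+1)) t,
    P *m P^t* = 1%:M ->
    remainder xbracket (spectrum s) (border N c) =
      P^t* *m diag_mx (\row_l (t l)%:C) *m P ->
    m%:R * N%:R * c ^+ 2 / 8 <= \sum_l `|t l|.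
Proof.
move=> m0 c0.
pose k : R := (N + N).+1%:R.
pose E : R := 4 * k ^+ 2 * c ^+ 3 * (3 + 2 * (1 + 2 ^+ N)).
have k0 : 0 <= 4 * k * c by rewrite !mulr_ge0// ltW.
have E0 : 0 <= E.
  by rewrite !mulr_ge0 ?exprn_ge0 ?addr_ge0 ?mulr_ge0 ?addr_ge0 ?exprn_ge0// ltW.
have cc0 : 0 < c ^+ 2 by rewrite exprn_gt0.
have Ec0 : 0 <= 8 * E / c ^+ 2 by rewrite divr_ge0 ?mulr_ge0// ltW.
pose s := 2 + 4 * k * c + 8 * E / c ^+ 2.
have s2 : 2 <= s by rewrite /s; lra.
exists s; first by lra.
move=> P t PPt XE; have m0' : 0 < m%:R :> R by rewrite ltr0n.
rewrite -(ler_pM2l m0').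
apply: le_trans (dyadic_hilbert_pairing t m0 PPt); rewrite -XE.
have -> : m%:R * (m%:R * N%:R * c ^+ 2 / 8) =
    \sum_p \sum_q `|dyadic_hilbert (m ^ 2) p q| * (c ^+ 2 / 8) :> R.
  under eq_bigr do rewrite -mulr_suml.
  by rewrite -mulr_suml sum_norm_dyadic_hilbert natrX -/N; ring.
apply: ler_sum => p _; apply: ler_sum => q _.
have h1 : 1 <= s by lra.
have h2 : 4 * (N + N).+1%:R * c <= s by rewrite /s -/k; lra.
have h := remainder_border p q (ltW c0) h1 h2.
have Es : E / s <= c ^+ 2 / 8.
  rewrite ler_pdivrMr; last lra.
  have : c ^+ 2 / 8 * (8 * E / c ^+ 2) = E by field; rewrite gt_eqF.
  have := mulr_ge0 (ltW cc0) k0; rewrite /s; lra.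
have {}h := le_trans h Es.
have := le_trans (normr_Re_le _) h; rewrite raddfB/= => {}h.
have [V0 V1 V2] := dyadic_hilbert_sign (R := R) p q.
move: h; rewrite ler_norml => /andP[].
move: (complex.Re (remainder _ _ _ _ _)) => r h3 h4.
have [pq|qp|pq] := ltngtP p q.
- have := loewner_kernel_ge s2 pq; rewrite loewner_kernelC => K.
  have K' := ler_wpM2l (ltW cc0) K.
  rewrite ler0_norm ?V1// mulNr -mulrN; apply: ler_wnM2l; first exact: V1.
  lra.
- have K := ler_wpM2l (ltW cc0) (loewner_kernel_ge s2 qp).
  rewrite ger0_norm ?V0//; apply: ler_wpM2l; first exact: V0.
  lra.
- by rewrite V2 ?normr0 ?mul0r//; exact: val_inj.
Qed.

End TraceNorm.

(** * Inner products on the blocks *)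

Section FiniteDot.
Context {R : realType}.
Local Notation C := R[i].
Local Open Scope sesquilinear_scope.

Lemma cdot0l k (v : 'cV[C]_k) : cdot 0 v = 0.
Proof. by rewrite /cdot big1// => j _; rewrite mxE mul0r. Qed.

Lemma cdot0r k (v : 'cV[C]_k) : cdot v 0 = 0.
Proof. by rewrite /cdot big1// => j _; rewrite mxE rmorph0 mulr0. Qed.

Lemma cdot_deltar k (u : 'cV[C]_k) j : cdot u (delta_mx j ord0) = u j ord0.
Proof.
rewrite /cdot (bigD1 j)//= mxE !eqxx rmorph1 mulr1 big1 ?addr0// => l lj.
by rewrite mxE (negbTE lj) rmorph0 mulr0.
Qed.

Lemma cdotZl k a (u v : 'cV[C]_k) : cdot (a *: u) v = a * cdot u v.
Proof. by rewrite /cdot mulr_sumr; apply: eq_bigr => j _; rewrite mxE mulrA. Qed.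

Lemma cdotC k (u v : 'cV[C]_k) : cdot v u = Num.conj (cdot u v).
Proof.
rewrite /cdot rmorph_sum; apply: eq_bigr => j _.
by rewrite rmorphM/= conjCK mulrC.
Qed.

Lemma cdot_herm k (A : 'M[C]_k) (u v : 'cV[C]_k) : A \is hermsymmx ->
  cdot (A *m u) v = cdot u (A *m v).
Proof.
move=> /hermsymmxE hA; rewrite /cdot.
under eq_bigr => i _ do rewrite mxE mulr_suml.
rewrite exchange_big; apply: eq_bigr => j _ /=.
rewrite mxE rmorph_sum mulr_sumr; apply: eq_bigr => i _.
by rewrite rmorphM/= [in LHS]hA !mxE mulrAC mulrC mulrA.
Qed.

Lemma cdot_normsq k (u : 'cV[C]_k) : cdot u u = (normsq u)%:C.
Proof.
rewrite /normsq RRe_real//; apply: ger0_real; apply: sumr_ge0 => j _.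
by rewrite -normCK exprn_ge0.
Qed.

Lemma normsq0 k : normsq (0 : 'cV[C]_k) = 0.
Proof. by rewrite /normsq cdot0l. Qed.

Lemma normsq_eq0 k (u : 'cV[C]_k) : normsq u = 0 -> u = 0.
Proof.
rewrite normsqE => /eqP; rewrite psumr_eq0; last first.
  by move=> j _; rewrite addr_ge0 ?sqr_ge0.
move=> /allP h; apply/matrixP => j l; rewrite mxE ord1.
have := h j (mem_index_enum _); rewrite paddr_eq0 ?sqr_ge0//= !sqrf_eq0.
by case: (u j ord0) => a b /= /andP[/eqP -> /eqP ->].
Qed.

Lemma normsq_mulmx k (B : 'M[C]_k) (u : 'cV[C]_k) :
  normsq (B *m u) <= (\sum_i \sum_j Normc.normc (B i j) ^+ 2) * normsq u.
Proof.
have nE (v : 'cV[C]_k) : normsq v = \sum_j Normc.normc (v j ord0) ^+ 2.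
  by rewrite normsqE; apply: eq_bigr => j _; rewrite normc_sqr.
rewrite !nE mulr_suml; apply: ler_sum => i _; rewrite mxE.
set b := fun j => Normc.normc (B i j); set w := fun j => Normc.normc (u j ord0).
apply: (@le_trans _ _ ((\sum_j b j * w j) ^+ 2)).
  rewrite ler_sqr ?nnegrE ?normc_ge0 ?sumr_ge0//; last first.
    by move=> j _; rewrite mulr_ge0 ?normc_ge0.
  apply: le_trans (normc_sum _) _; apply: ler_sum => j _.
  by rewrite Normc.normcM.
rewrite -subr_ge0.
have -> : (\sum_j b j ^+ 2) * (\sum_j w j ^+ 2) - (\sum_j b j * w j) ^+ 2 =
   (\sum_j \sum_l (b j * w l - b l * w j) ^+ 2) / 2.
  rewrite expr2 !big_distrlr/=.
  have e : \sum_j \sum_l b j ^+ 2 * w l ^+ 2 = \sum_j \sum_l b l ^+ 2 * w j ^+ 2.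
    by rewrite exchange_big.
  suff -> : \sum_j \sum_l (b j * w l - b l * w j) ^+ 2 =
    \sum_j \sum_l b j ^+ 2 * w l ^+ 2 + \sum_j \sum_l b l ^+ 2 * w j ^+ 2
    - 2 * \sum_j \sum_l (b j * w j) * (b l * w l) by rewrite -e; field.
  rewrite mulr_sumr -big_split -sumrB; apply: eq_bigr => j _.
  rewrite mulr_sumr -big_split -sumrB; apply: eq_bigr => l _ /=; ring.
by rewrite divr_ge0// sumr_ge0// => j _; rewrite sumr_ge0// => l _; exact: sqr_ge0.
Qed.

End FiniteDot.

(** * Vectors supported in one block *)

Section Blocks.
Context {R : realType} {d : nat -> nat}.
Local Notation C := R[i].
Local Notation H := (@hsum R d).

Lemma hsumE (x y : H) : (forall n, x n = y n) -> x = y.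
Proof. by move=> xy; apply: val_inj; apply: functional_extensionality_dep. Qed.

Lemma hsumD (x y : H) n : (x + y) n = x n + y n.
Proof. by []. Qed.

Lemma hsumN (x : H) n : (- x) n = - x n.
Proof. by []. Qed.

Lemma hsumZ a (x : H) n : (a *: x) n = a *: x n.
Proof. by []. Qed.

Lemma hsum0 n : (0 : H) n = 0.
Proof. by []. Qed.

Lemma hsum_sum I (r : seq I) (F : I -> H) n :
  (\sum_(i <- r) F i) n = \sum_(i <- r) F i n.
Proof. by elim/big_rec2: _ => // i y x _ <-. Qed.

Lemma hbasis_same n (j : 'I_(d n)) : @hbasis R d n j n = delta_mx j ord0.
Proof. by apply/colP => l; rewrite !mxE !eqxx/= andbT. Qed.

Lemma hbasis_other n (j : 'I_(d n)) m : m != n -> @hbasis R d n j m = 0.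
Proof. by move=> /negbTE mn; apply/colP => l; rewrite !mxE mn. Qed.

(** Expanding [u] in the standard basis avoids a transport along an equality of
    block indices. *)
Definition emb n (u : 'cV[C]_(d n)) : H := \sum_j u j ord0 *: @hbasis R d _ j.

Lemma emb_same n (u : 'cV[C]_(d n)) : emb u n = u.
Proof.
rewrite /emb hsum_sum; apply/colP => l; rewrite summxE (bigD1 l)// big1.
  by rewrite [LHS]addr0 hsumZ hbasis_same mxE mxE !eqxx mulr1.
by move=> j jl; rewrite hsumZ hbasis_same !mxE eq_sym (negbTE jl) mulr0.
Qed.

Lemma emb_other n (u : 'cV[C]_(d n)) m : m != n -> emb u m = 0.
Proof.
move=> mn; rewrite /emb hsum_sum big1// => j _.
by rewrite hsumZ hbasis_other// scaler0.
Qed.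

Lemma emb_delta n (j : 'I_(d n)) : emb (delta_mx j ord0) = @hbasis R d _ j.
Proof.
apply: hsumE => m; have [->|mn] := eqVneq m n.
  by rewrite emb_same hbasis_same.
by rewrite emb_other// hbasis_other.
Qed.

Lemma limn_series1 (u : nat -> C) n :
  (forall m, m != n -> u m = 0) -> limn (series u) = u n.
Proof.
move=> un; apply: cvg_lim; first exact: norm_hausdorff.
apply: cvg_near_cst; near=> k; rewrite /series/=.
have nk : (n < k)%N by near: k; exact: nbhs_infty_gt.
rewrite (bigD1_seq n) ?mem_index_iota ?iota_uniq//= big1 ?addr0//.
Unshelve. all: by end_near. Qed.

Lemma hdot_embr (x : H) n (u : 'cV[C]_(d n)) : hdot x (emb u) = cdot (x n) u.
Proof.
rewrite /hdot (limn_series1 (n := n)) ?emb_same// => m mn.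
by rewrite emb_other// cdot0r.
Qed.

Lemma hdot_embl (x : H) n (u : 'cV[C]_(d n)) : hdot (emb u) x = cdot u (x n).
Proof.
rewrite /hdot (limn_series1 (n := n)) ?emb_same// => m mn.
by rewrite emb_other// cdot0l.
Qed.

Lemma hsum_ext (x y : H) :
  (forall n (j : 'I_(d n)), hdot x (@hbasis R d _ j) = hdot y (@hbasis R d _ j)) -> x = y.
Proof.
move=> xy; apply: hsumE => n; apply/colP => j.
by have := xy n j; rewrite -emb_delta !hdot_embr !cdot_deltar.
Qed.

Lemma nneseries1 (f : nat -> \bar R) n :
  (forall m, 0 <= f m)%E -> (forall m, m != n -> f m = 0)%E ->
  (\sum_(k <oo) f k = f n)%E.
Proof.
move=> f0 fn; rewrite (nneseriesD1 (n := n))//.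
by rewrite eseries0 ?adde0// => m _; exact: fn.
Qed.

Lemma hnorm_emb_sqr n (u : 'cV[C]_(d n)) : hnorm (emb u) ^+ 2 = normsq u.
Proof.
rewrite /hnorm (nneseries1 (n := n)).
- by rewrite emb_same/= sqr_sqrtr// normsq_ge0.
- by move=> m; rewrite lee_fin normsq_ge0.
- by move=> m mn; rewrite emb_other// normsq0.
Qed.

Lemma hsum_summable (x : H) : (\sum_(n <oo) (normsq (x n))%:E < +oo)%E.
Proof. by case: x => x /= /square_summableP. Qed.

End Blocks.

(** * Direct sums of matrices as operators *)

Section Operators.
Context {R : realType} {d : nat -> nat}.
Local Notation C := R[i].
Local Notation H := (@hsum R d).
Local Notation e_ j := (@hbasis R d _ j).

Lemma sum_emb_nat (v : forall n, 'cV[C]_(d n)) N m :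
  (\sum_(n < N) emb (v n) : H) m = if (m < N)%N then v m else 0.
Proof.
rewrite hsum_sum; case: ltnP => mN.
  rewrite (bigD1 (Ordinal mN))// big1 => [|j jm]; first by rewrite [LHS]addr0 emb_same.
  by rewrite emb_other// eq_sym.
by rewrite big1// => j _; rewrite emb_other// gtn_eqF// (leq_trans _ mN).
Qed.

Lemma hnorm_truncation (x : H) (e : R) : 0 < e ->
  exists N, hnorm (x - \sum_(n < N) emb (x n)) < e.
Proof.
move=> e0.
have x0 k : (0 <= (normsq (x k))%:E)%E by rewrite lee_fin normsq_ge0.
have tail := nneseries_tail_cvg (P := xpredT) (hsum_summable x) (fun k _ => x0 k).
have [N] : exists N, (\sum_(N <= k <oo) (normsq (x k))%:E < (e ^+ 2)%:E)%E.
  have e2 : (0 < (e ^+ 2)%:E)%E by rewrite lte_fin exprn_gt0.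
  have [N _ h] : \forall N \near \oo, (\sum_(N <= k <oo) (normsq (x k))%:E < (e ^+ 2)%:E)%E.
    exact: (tail _ (open_ereal_lt' e2)).
  by exists N; apply: h => /=.
move=> hN; exists N; rewrite /hnorm.
set y : H := x - _.
have yE k : y k = if (k < N)%N then 0 else x k.
  rewrite /y hsumD hsumN sum_emb_nat; case: ifP => _; first by rewrite subrr.
  by rewrite subr0.
have -> : (\sum_(n <oo) (normsq (y n))%:E = \sum_(N <= k <oo) (normsq (x k))%:E)%E.
  rewrite (nneseries_split 0 N); last by move=> k _; rewrite lee_fin normsq_ge0.
  rewrite add0n big1_seq ?add0e; last first.
    by move=> k; rewrite mem_index_iota => /andP[_ /andP[_ kN]]; rewrite yE kN normsq0.
  rewrite [LHS]eseries_cond [RHS]eseries_cond.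
  by apply: eq_eseriesr => k /andP[_ kN]; rewrite yE ltnNge kN.
rewrite -[ltRHS]ger0_norm ?ltW// -sqrtr_sqr ltr_sqrt ?exprn_gt0//.
have t0 : (0 <= \sum_(N <= k <oo) (normsq (x k))%:E)%E by apply: nneseries_ge0.
move: hN t0; case: (limn _) => //= r.
Qed.

Lemma dsum_op_emb (A : forall n, 'M[C]_(d n)) n (u : 'cV[C]_(d n)) :
  dsum_op A (emb u : H, emb (A n *m u) : H).
Proof.
move=> m /=; have [->|mn] := eqVneq m n; first by rewrite !emb_same.
by rewrite !emb_other// mulmx0.
Qed.

(** Finitely supported vectors lie in the domain, are dense, and suffice to
    identify the adjoint block by block. *)
Lemma selfadjoint_dsum_op (A : forall n, 'M[C]_(d n)) :
  (forall n, A n \is hermsymmx) -> selfadjoint_op (dsum_op A).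
Proof.
move=> hA; split=> [x e e0|].
  have [N hN] := hnorm_truncation x e0.
  exists (\sum_(n < N) emb (x n), \sum_(n < N) emb (A n *m x n)); split=> //= m.
  rewrite (sum_emb_nat (fun n => A n *m x n)) (sum_emb_nat x).
  by case: ifP => // _; rewrite mulmx0.
apply/seteqP; split=> [q qG|q qA].
  move=> n; apply/colP => j.
  have := qG _ (dsum_op_emb A (delta_mx j ord0)); rewrite /= !hdot_embl cdot_herm//.
  move=> /(congr1 Num.conj); rewrite -!cdotC !cdot_deltar => <- //.
move=> p pA; rewrite /hdot; congr (limn (series _)); apply: funext => n.
by rewrite pA qA cdot_herm.
Qed.

(** The Frobenius norms bound the operator norms of the blocks, and they are
    bounded since their squares are summable: the direct sum is everywhere
    defined. *)
Lemma hilbert_schmidt_dsum_op (B : forall n, 'M[C]_(d n)) :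
  (\sum_(n <oo) (\sum_i \sum_j Normc.normc (B n i j) ^+ 2)%:E < +oo)%E ->
  hilbert_schmidt (dsum_op B).
Proof.
set w := fun n => \sum_i \sum_j Normc.normc (B n i j) ^+ 2.
move=> wfin.
have w0 n : (0 <= (w n)%:E)%E.
  by rewrite lee_fin; apply: sumr_ge0 => i _; apply: sumr_ge0 => j _; exact: sqr_ge0.
pose S := fine (\sum_(n <oo) (w n)%:E)%E.
have SE : (S%:E = \sum_(n <oo) (w n)%:E)%E.
  by rewrite fineK// ge0_fin_numE// nneseries_ge0.
have S0 : 0 <= S by rewrite -lee_fin SE nneseries_ge0.
have wS n : w n <= S.
  rewrite -lee_fin SE (nneseriesD1 (n := n))// leeDl//.
  exact: nneseries_ge0.
have nx0 (x : H) n : (0 <= (normsq (x n))%:E)%E by rewrite lee_fin normsq_ge0.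
have le (x : H) n : normsq (B n *m x n) <= S * normsq (x n).
  apply: le_trans (normsq_mulmx _ _) _; rewrite ler_wpM2r ?normsq_ge0//; exact: wS.
have les (x : H) : (\sum_(n <oo) (normsq (B n *m x n))%:E <=
    S%:E * \sum_(n <oo) (normsq (x n))%:E)%E.
  rewrite -nneseriesZl//; apply: lee_nneseries => n _; last by rewrite -EFinM lee_fin.
  by move=> _; rewrite lee_fin normsq_ge0.
have sumP (x : H) : ((fun n => B n *m x n) : Defs.family R d) \in @square_summable R d.
  apply/square_summableP; apply: le_lt_trans (les x) _.
  by rewrite lte_mul_pinfty// ?lee_fin// hsum_summable.
pose T (x : H) : H := HSum (sumP x).
have Tlin : linear T.
  move=> a x y; apply: hsumE => n; rewrite hsumD hsumZ.
  by rewrite [LHS]mulmxDr -scalemxAr.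
pose TL := HB.pack_for {linear H -> H} T (GRing.isLinear.Build _ _ _ _ T Tlin).
exists TL; split.
- apply/seteqP; split=> [p pB|p pT n]; last by rewrite (pT : p.2 = TL p.1).
  by apply: hsumE => n; exact: pB.
- exists (Num.sqrt S) => x.
  rewrite /hnorm -sqrtrM// ler_sqrt; last first.
    by rewrite mulr_ge0// fine_ge0// nneseries_ge0.
  clearbody S; rewrite -lee_fin EFinM !fineK.
  + exact: les.
  + by rewrite ge0_fin_numE ?nneseries_ge0// hsum_summable.
  + rewrite ge0_fin_numE ?hsum_summable//.
    by apply: nneseries_ge0 => n _ _; rewrite lee_fin normsq_ge0.
- apply: le_lt_trans wfin; apply: lee_nneseries => n _.
    by move=> _; apply: sume_ge0 => j _; rewrite lee_fin sqr_ge0.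
  rewrite sumEFin lee_fin /w exchange_big; apply: ler_sum => j _ /=.
  have -> : T (e_ j) = emb (col j (B n)).
    apply: hsumE => m; rewrite -[LHS]/(B m *m e_ j m).
    have [->|mn] := eqVneq m n; first by rewrite hbasis_same emb_same colE.
    by rewrite hbasis_other// emb_other// mulmx0.
  rewrite hnorm_emb_sqr normsqE; apply: ler_sum => i _.
  by rewrite mxE -normc_sqr.
Qed.

End Operators.

(** * Trace class direct sums *)

Section TraceClass.
Context {R : realType} {d : nat -> nat}.
Local Notation C := R[i].
Local Notation H := (@hsum R d).
Local Notation e_ j := (@hbasis R d _ j).
Local Open Scope sesquilinear_scope.

Lemma cvg_real_complex (u : nat -> R) (l : R) :
  (u n @[n --> \oo] --> l) -> ((u n)%:C : C) @[n --> \oo] --> (l%:C : C).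
Proof.
move=> ul; apply/cvgrPdist_lt => e e0.
have [r eE] : exists r : R, e = r%:C.
  by exists (complex.Re e); rewrite RRe_real// gtr0_real.
move: e0; rewrite {}eE ltcR => r0.
move/cvgrPdist_lt : ul => /(_ r r0); apply: filterS => n.
by rewrite -rmorphB norm_normc normc_real ltcR.
Qed.

(** The vector [w] has infinitely many nonzero blocks in general; these are the
    inner products of such vectors to which positivity is applied below. *)
Lemma hdot_perturbed_self (w : H) : exists2 L : R,
  forall n, normsq (w n) <= L &
  forall (a b : R) n (v : 'cV[C]_(d n)),
    hdot (a%:C *: w) (w + b%:C *: emb v) =
    (a * L)%:C + (a * b)%:C * cdot (w n) v.
Proof.
set f := fun n => (normsq (w n))%:E.
have f0 n : (0 <= f n)%E by rewrite lee_fin normsq_ge0.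
pose L := fine (\sum_(n <oo) f n)%E.
have LE : (L%:E = \sum_(n <oo) f n)%E.
  by rewrite fineK// ge0_fin_numE ?hsum_summable// nneseries_ge0.
have cvgL : series (fun n => normsq (w n)) n @[n --> \oo] --> L.
  have : (\sum_(0 <= i < n) f i)%E @[n --> \oo] --> L%:E.
    by rewrite LE; apply: is_cvg_nneseries => *; exact: f0.
  move/fine_cvg; apply: cvg_trans; apply: near_eq_cvg; apply: nearW => n.
  by rewrite /= sumEFin.
exists L => [n|a b n v].
  rewrite -lee_fin LE (nneseriesD1 (n := n))// leeDl//; exact: nneseries_ge0.
pose g m := (a * normsq (w m))%:C : C.
pose h m := (a * b)%:C * cdot (w m) (emb v m) : C.
have e m : cdot ((a%:C *: w) m) ((w + b%:C *: emb v) m) = g m + h m.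
  rewrite /g /h hsumZ hsumD hsumZ cdotZl.
  have -> : cdot (w m) (w m + b%:C *: emb v m) =
      cdot (w m) (w m) + b%:C * cdot (w m) (emb v m).
    rewrite /cdot mulr_sumr -big_split; apply: eq_bigr => j _ /=.
    rewrite !mxE rmorphD rmorphM/= conj_complex_real; ring.
  by rewrite mulrDr cdot_normsq mulrA !rmorphM.
rewrite /hdot (funext e); apply: cvg_lim; first exact: norm_hausdorff.
have -> : series (fun m => g m + h m) = series g \+ series h.
  by apply/funext => m; rewrite /series/= big_split.
apply: cvgD.
  have -> : series g = (fun m => (a * series (fun n => normsq (w n)) m)%:C : C).
    apply/funext => m; rewrite /series/= mulr_sumr rmorph_sum.
    by apply: eq_bigr => k _.
  by apply: cvg_real_complex; apply: cvgM => //; exact: cvg_cst.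
have -> : (a * b)%:C * cdot (w n) v = h n by rewrite /h emb_same.
apply: cvg_near_cst; near=> k; rewrite /series/=.
have nk : (n < k)%N by near: k; exact: nbhs_infty_gt.
rewrite (bigD1_seq n) ?mem_index_iota ?iota_uniq//= big1 ?addr0// => m mn.
by rewrite /h emb_other// cdot0r mulr0.
Unshelve. all: by end_near. Qed.

(** Here [w = P u - |t| u] satisfies [P w = - |t| w], which positivity of [P] at
    [w] forbids unless [w = 0] or [t = 0]; in the latter case [P w = 0] and
    positivity at the vectors [w + s u] forbids [w <> 0]. *)
Lemma positive_sqrt_eigenvector (P : {linear H -> H}) n (v : 'cV[C]_(d n)) (t : R) :
  positive_op P -> P (P (emb v)) = (t ^+ 2)%:C *: emb v ->
  P (emb v) = `|t|%:C *: emb v.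
Proof.
move=> Ppos PPu; set u := emb v in PPu *.
pose w := P u - `|t|%:C *: u.
have Pw : P w = (- `|t|)%:C *: w.
  rewrite /w linearB linearZ/= PPu -(real_normK (num_real t)) rmorphN scaleNr.
  by rewrite scalerBr scalerA -rmorphM -expr2 opprB.
have [L wL hL] := hdot_perturbed_self w.
suff L0 : L <= 0.
  apply/eqP; rewrite -subr_eq0 -/w; apply/eqP; apply: hsumE => m; rewrite hsum0.
  by apply: normsq_eq0; apply: le_anti; rewrite normsq_ge0 (le_trans (wL m)).
have [t0|t0] := eqVneq t 0; last first.
  have := Ppos w; rewrite Pw; have := hL (- `|t|) 0 n v.
  rewrite rmorph0 scale0r addr0 mulr0 rmorph0 mul0r addr0 => ->.
  rewrite ler0c mulNr oppr_ge0 pmulr_rle0// normr_gt0//.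
have wE : P u = w by rewrite /w t0 normr0 rmorph0 scale0r subr0.
have Pw0 : P w = 0 by rewrite Pw t0 normr0 oppr0 rmorph0 scale0r.
rewrite leNgt; apply/negP => L0.
pose rho := complex.Re (cdot (w n) v).
have pos s : 0 <= s * L + s * s * rho.
  have := Ppos (w + s%:C *: u).
  rewrite linearD linearZ/= Pw0 add0r wE hL lecE => /andP[_].
  by rewrite raddfD/= /rho; case: (cdot _ _) => p q /=; rewrite mul0r subr0.
have r1 : 0 < 2 * (`|rho| + 1) by rewrite mulr_gt0// ltr_pwDr.
have := pos (- (L / (2 * (`|rho| + 1)))).
have c0 : 0 < L / (2 * (`|rho| + 1)) by rewrite divr_gt0.
set c := L / _ in c0 *.
have cL : c * (2 * (`|rho| + 1)) = L by rewrite /c divfK// gt_eqF.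
have h : c * rho <= c * `|rho| by rewrite ler_wpM2l ?ler_norm// ltW.
have h0 : 0 <= c * `|rho| by rewrite mulr_ge0// ltW.
have : c * (c * rho) <= c * (L / 2) by rewrite ler_wpM2l ?(ltW c0)//; lra.
have := mulr_gt0 c0 L0; lra.
Qed.

Lemma emb_lincomb n k (a : 'I_k -> C) (v : 'I_k -> 'cV[C]_(d n)) :
  emb (\sum_l a l *: v l) = \sum_l a l *: emb (v l) :> H.
Proof.
apply: hsumE => m; rewrite [RHS]hsum_sum; have [->|mn] := eqVneq m n.
  by rewrite emb_same; apply: eq_bigr => l _; rewrite hsumZ emb_same.
rewrite emb_other// big1// => l _; by rewrite hsumZ emb_other// scaler0.
Qed.

Section BlockTrace.
Variables (X : forall n, 'M[C]_(d n)) (T P : {linear H -> H}).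
Hypotheses (hX : forall n, X n \is hermsymmx) (XT : dsum_op X = graph_of T).
Hypothesis TP : is_absolute_value T P.

Let TE (x : H) n : T x n = X n *m x n.
Proof.
have : graph_of T (x, T x) by [].
by rewrite -XT => /(_ n).
Qed.

Lemma absolute_value_eigenvector n (v : 'cV[C]_(d n)) t :
  X n *m v = t%:C *: v -> P (emb v) = `|t|%:C *: emb v.
Proof.
move=> Xv; have [_ Ppos PP] := TP.
have Tv : T (emb v) = t%:C *: emb v.
  apply: hsumE => m; rewrite TE hsumZ; have [->|mn] := eqVneq m n.
    by rewrite emb_same.
  by rewrite emb_other// mulmx0 scaler0.
apply: positive_sqrt_eigenvector => //; apply: hsum_ext => m j.
have Tej : T (e_ j) = emb (X m *m delta_mx j ord0).
  apply: hsumE => l; rewrite TE -emb_delta; have [->|lm] := eqVneq l m.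
    by rewrite !emb_same.
  by rewrite !emb_other// mulmx0.
rewrite PP Tej hdot_embr -cdot_herm// -TE Tv linearZ/= Tv.
by rewrite -emb_delta hdot_embr scalerA -rmorphM -expr2.
Qed.

(** The absolute value acts on the eigenvectors of each block as expected, which
    gives its diagonal entries there without knowing beforehand that it is block
    diagonal. *)
Lemma absolute_value_block_trace n (Q : 'M[C]_(d n)) (t : 'I_(d n) -> R) :
  Q *m Q^t* = 1%:M -> Q^t* *m Q = 1%:M ->
  X n = Q^t* *m diag_mx (\row_l (t l)%:C) *m Q ->
  \sum_(j < d n) complex.Re (hdot (P (e_ j)) (e_ j)) = \sum_l `|t l|.
Proof.
move=> QQt QtQ XE; pose v l : 'cV[C]_(d n) := Q^t* *m delta_mx l ord0.
have Pv l : P (emb (v l)) = `|t l|%:C *: emb (v l).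
  apply: absolute_value_eigenvector; rewrite XE /v !mulmxA -(mulmxA _ Q) QQt mulmx1.
  rewrite -mulmxA scalemxAr; congr (_ *m _); apply/matrixP => i k.
  by rewrite mul_diag_mx !mxE; case: eqVneq => [->|_]; rewrite /= ?mulr0.
have ej (j : 'I_(d n)) : (e_ j : H) = \sum_l Q l j *: emb (v l).
  rewrite -emb_delta -emb_lincomb; congr (emb _).
  rewrite -[LHS]mul1mx -QtQ -mulmxA.
  under [RHS]eq_bigr => l _ do rewrite /v scalemxAr.
  rewrite -mulmx_sumr; congr (_ *m _); apply/colP => i; rewrite -colE.
  rewrite mxE summxE (bigD1 i)//= !mxE !eqxx mulr1 big1 ?addr0// => l li.
  by rewrite !mxE eq_sym (negbTE li) mulr0.
have tr (j : 'I_(d n)) : complex.Re (hdot (P (e_ j)) (e_ j)) =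
    \sum_l `|t l| * Normc.normc (Q l j) ^+ 2.
  rewrite {1}ej linear_sum -emb_delta hdot_embr cdot_deltar hsum_sum summxE.
  rewrite raddf_sum; apply: eq_bigr => l _.
  have -> : P (Q l j *: emb (v l)) = Q l j *: P (emb (v l)) by exact: linearZ.
  rewrite Pv 2!hsumZ emb_same mxE [X in _ * X]mxE.
  have -> : (v l) j ord0 = Num.conj (Q l j).
    by rewrite /v -colE !mxE.
  by rewrite mulrCA [Q l j * _]mulrC mul_conjC -rmorphM.
rewrite (eq_bigr _ (fun j _ => tr j)) exchange_big; apply: eq_bigr => l _ /=.
by rewrite -mulr_sumr unitary_row_normsq// mulr1.
Qed.

End BlockTrace.

Lemma not_trace_class_dsum_op (X : forall n, 'M[C]_(d n)) (delta : R) :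
  0 < delta -> (forall n, X n \is hermsymmx) ->
  (forall n (Q : 'M[C]_(d n)) (t : 'I_(d n) -> R), Q *m Q^t* = 1%:M ->
     X n = Q^t* *m diag_mx (\row_l (t l)%:C) *m Q -> delta <= \sum_l `|t l|) ->
  ~ trace_class (dsum_op X).
Proof.
move=> delta0 hX hdelta [T [XT _ [P TP]]]; apply/negP; rewrite -leNgt.
set F := fun n => (\sum_(j < d n) (complex.Re (hdot (P (e_ j)) (e_ j)))%:E)%E.
have Fd n : (delta%:E <= F n)%E.
  have [Q [t [QQt QtQ XE _]]] := spectral_decomposition (hX n).
  rewrite /F sumEFin lee_fin (absolute_value_block_trace hX XT TP QQt QtQ XE).
  exact: hdelta QQt XE.
have F0 n : (0 <= F n)%E by apply: le_trans (Fd n); rewrite lee_fin ltW.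
have ge k : ((delta * k%:R)%:E <= postrace P)%E.
  apply: le_trans (nneseries_lim_ge k (fun n _ _ => F0 n)).
  apply: (@le_trans _ _ (\sum_(0 <= i < k) delta%:E)%E).
    by rewrite sumEFin lee_fin sumr_const_nat subn0 mulr_natr.
  by apply: lee_sum => i _; exact: Fd.
move: ge; case: (postrace P) => [r||] ge //; last by have := ge 0%N.
have := ge (Num.truncn (r / delta)).+1; rewrite lee_fin => h.
have h' : r < delta * (Num.truncn (r / delta)).+1%:R.
  by rewrite [delta * _]mulrC -ltr_pdivrMr// truncnS_gt.
by have := lt_le_trans h' h; rewrite ltxx.
Qed.

End TraceClass.

(** * The counterexample *)

Lemma geometric_summable (R : realType) :
  (\sum_(n <oo) (4 * 2^-1 ^+ n : R)%:E < +oo)%E.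
Proof.
have part k : \sum_(0 <= i < k) 4 * 2^-1 ^+ i = 8 - 8 * 2^-1 ^+ k :> R.
  elim: k => [|k IH]; first by rewrite big_geq// expr0; ring.
  by rewrite big_nat_recr//= IH exprS; field.
apply: (@le_lt_trans _ _ 8%:E); last exact: ltry.
apply: lime_le.
  by apply: is_cvg_nneseries => n _ _; rewrite lee_fin mulr_ge0 ?exprn_ge0.
apply: nearW => k; rewrite sumEFin lee_fin part.
by rewrite gerBl mulr_ge0// exprn_ge0.
Qed.

Theorem theorem29 (R : realType) :
  exists (f : R -> R) (d : nat -> nat)
         (A B D : forall n : nat, 'M[R[i]]_(d n)),
    [/\ C2_bounded_second_derivative f,
        (forall n, A n \is hermsymmx) /\ selfadjoint_op (dsum_op A),
        [/\ forall n, B n \is hermsymmx, selfadjoint_op (dsum_op B)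
          & hilbert_schmidt (dsum_op B)],
        forall n,
          is_mxderive0 (fun t : R => funcalc f (A n + t%:C *: B n)) (D n)
      & ~ trace_class (dsum_op (fun n =>
            funcalc f (A n + B n) - funcalc f (A n) - D n))].
Proof.
(* the gain [m] of the trace norm compensates the decay [2^-n] of [c^2 N] *)
pose m n := (2 ^ n)%N.
pose N n := dyadic_size (m n ^ 2).
have N0 n : 0 < (N n)%:R :> R by rewrite ltr0n dyadic_size_gt0.
(* so that the squared Hilbert-Schmidt norm of the block is [4 / 2^n] *)
pose c n : R := Num.sqrt (2^-1 ^+ n / (N n)%:R).
have c2 n : (N n)%:R * c n ^+ 2 = 2^-1 ^+ n.
  rewrite sqr_sqrtr; last by rewrite divr_ge0 ?exprn_ge0.
  by rewrite mulrC divfK// gt_eqF.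
have c0 n : 0 < c n by rewrite sqrtr_gt0 divr_gt0// exprn_gt0.
have m0 n : (0 < m n)%N by rewrite expn_gt0.
have [s hs] := choice (fun n =>
  let: ex_intro2 s s0 hs := trace_norm_lower (m0 n) (c0 n)
  in ex_intro (fun s => 0 < s /\ _) s (conj s0 hs)).
pose B n := border (N n) (c n).
have hB n : B n \is hermsymmx := border_herm _ _.
exists xbracket, (fun n => (N n + N n).+1),
  (fun n => diag_mx (\row_j (spectrum (s n) j)%:C)), B,
  (fun n => schur_divdiff xbracket (spectrum (s n)) (B n)).
have hA n : diag_mx (\row_j (spectrum (s n) j)%:C) \is hermsymmx :=
  diag_real_herm (spectrum (N := N n) (s n)).
split.
- exact: xbracket_C2.
- by split=> //; exact: selfadjoint_dsum_op.
- split=> //; first exact: selfadjoint_dsum_op.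
  apply: hilbert_schmidt_dsum_op.
  under eq_eseriesr do rewrite border_normsq -mulrA c2.
  exact: geometric_summable.
- move=> n; have [s0 _] := hs n.
  apply: (mxderive0_funcalc taylor2_xbracket (hB n) (border_diag _) s0) => i j.
  exact: spectrum_gap.
- apply: (not_trace_class_dsum_op (delta := 8^-1)
    (X := fun n => remainder xbracket (spectrum (s n)) (B n))).
  + by rewrite invr_gt0.
  + by move=> n; exact: remainder_herm.
  + move=> n Q t QQt XE; have [_ /(_ Q t QQt XE)] := hs n.
    rewrite -(mulrA (m n)%:R) -/(N n) c2 natrX -exprMn divff// expr1n mul1r.
    exact: id.
Qed.
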